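(* Let $D$ be a connected digraph and $\Delta$ be an integer such that $\Delta_{\max}(D)\leq\Delta$ and $\overleftrightarrow{\omega}(D)\geq\frac23(\Delta+1)$. Then $D$ has an acyclic set of vertices $I$ such that $\overleftrightarrow{\omega}(D-I)=\overleftrightarrow{\omega}(D)-1$, unless $D$ is (isomorphic to) $\overleftrightarrow{C_n\circ K_p}$ with $n\geq5$ odd and $p=\frac12\overleftrightarrow{\omega}(D)=\frac13(\Delta+1)$.
   Context: Digraphs are finite, without loops and without parallel arcs (two opposite arcs $uv$ and $vu$ are allowed and form a digon). A digraph is connected if its underlying undirected graph is connected. For a vertex $v$, $d^+(v)$ and $d^-(v)$ are its out-degree and in-degree, and $\Delta_{\max}(D)=\max_{v\in V(D)}\max(d^+(v),d^-(v))$. A biclique of $D$ is a set of vertices that are pairwise linked by two arcs in opposite directions; $\overleftrightarrow{\omega}(D)$ is the maximum size of a biclique of $D$ (equal to $0$ for the digraph with no vertices). A set of vertices is acyclic if it induces a subdigraph without directed cycles (a digon is a directed cycle of length 2). $D-I$ is $D$ with the vertices in $I$ deleted. For an undirected graph $G$, $\overleftrightarrow{G}$ is the digraph obtained from $G$ by replacing every edge with two arcs in opposite directions. $C_n$ is the (undirected) cycle on $n$ vertices and $K_p$ the complete graph on $p$ vertices. The lexicographic product $G\circ G'$ is the graph with vertex-set $V(G)\times V(G')$ and edge-set $\{(u,u')(v,v') : uv\in E(G)\text{ or }(u=v\text{ and }u'v'\in E(G'))\}$. *)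

(* Defs.v *)
From mathcomp Require Import all_boot.

Set Implicit Arguments.
Unset Strict Implicit.
Unset Printing Implicit Defensive.

(* A relation allows at most one arc from u to v, and independently one from
   v to u: no parallel arcs, but digons are possible. *)
Record digraph := Digraph {
  vertex :> finType;
  arc : rel vertex;
  arc_irr : irreflexive arc }.

Record ugraph := UGraph {
  uvertex :> finType;
  edge : rel uvertex;
  edge_sym : symmetric edge;
  edge_irr : irreflexive edge }.

Definition connected_digraph (D : digraph) : Prop :=
  forall u v : D, connect (fun x y : D => arc x y || arc y x) u v.

Definition outdeg (D : digraph) (v : D) : nat := #|[set w : D | arc v w]|.
Definition indeg (D : digraph) (v : D) : nat := #|[set w : D | arc w v]|.

Definition maxdeg (D : digraph) : nat :=
  \max_(v : D) maxn (outdeg v) (indeg v).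

Definition biclique (D : digraph) (A : {set D}) : bool :=
  [forall u in A, forall v in A, (u != v) ==> arc u v && arc v u].

Definition biclique_number (D : digraph) : nat :=
  \max_(A : {set D} | biclique A) #|A|.

Section Induced.
Variables (D : digraph) (A : {set D}).

Definition induced_arc : rel {v : D | v \in A} :=
  fun u v => arc (val u) (val v).

Lemma induced_arc_irr : irreflexive induced_arc.
Proof. by move=> u; rewrite /induced_arc arc_irr. Qed.

Definition induced : digraph := Digraph induced_arc_irr.
End Induced.

Definition del_vertices (D : digraph) (I : {set D}) : digraph :=
  induced (~: I).

(* Since there are no loops, such a sequence has size at least 2; size 2 is a
   digon. *)
Definition dicycle (D : digraph) (c : seq D) : bool :=
  [&& c != [::], uniq c & cycle (@arc D) c].

Definition acyclic_digraph (D : digraph) : Prop :=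
  forall c : seq D, ~~ dicycle c.

Definition acyclic_set (D : digraph) (A : {set D}) : Prop :=
  acyclic_digraph (induced A).

Definition digraph_iso (D D' : digraph) : Prop :=
  exists2 f : D -> D', bijective f & forall u v : D, arc (f u) (f v) = arc u v.

Definition bidirected (G : ugraph) : digraph := Digraph (@edge_irr G).

(* ordS is the successor modulo n. The conjunct i != j only matters for n = 1,
   where it excludes a loop; the graph is the n-cycle for n >= 3. *)
Definition cycle_edge (n : nat) : rel 'I_n :=
  fun i j => (i != j) && ((j == ordS i) || (i == ordS j)).

Lemma cycle_edge_sym n : symmetric (@cycle_edge n).
Proof. by move=> i j; rewrite /cycle_edge eq_sym orbC. Qed.

Lemma cycle_edge_irr n : irreflexive (@cycle_edge n).
Proof. by move=> i; rewrite /cycle_edge eqxx. Qed.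

Definition cycle_graph (n : nat) : ugraph :=
  UGraph (@cycle_edge_sym n) (@cycle_edge_irr n).

Definition complete_edge (p : nat) : rel 'I_p := fun i j => i != j.

Lemma complete_edge_sym p : symmetric (@complete_edge p).
Proof. by move=> i j; rewrite /complete_edge eq_sym. Qed.

Lemma complete_edge_irr p : irreflexive (@complete_edge p).
Proof. by move=> i; rewrite /complete_edge eqxx. Qed.

Definition complete_graph (p : nat) : ugraph :=
  UGraph (@complete_edge_sym p) (@complete_edge_irr p).

Section LexProduct.
Variables G G' : ugraph.

Definition lex_edge : rel (G * G') :=
  fun x y => edge x.1 y.1 || ((x.1 == y.1) && edge x.2 y.2).

Lemma lex_edge_sym : symmetric lex_edge.
Proof.
move=> x y; rewrite /lex_edge (edge_sym x.1) (edge_sym x.2).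
by rewrite (eq_sym x.1).
Qed.

Lemma lex_edge_irr : irreflexive lex_edge.
Proof. by move=> x; rewrite /lex_edge !edge_irr andbF. Qed.

Definition lex_product : ugraph := UGraph lex_edge_sym lex_edge_irr.
End LexProduct.

(* Main.v *)
Require Import Defs.
From mathcomp Require Import all_boot all_order all_algebra.
From mathcomp Require Import zify lra.

Set Implicit Arguments.
Unset Strict Implicit.
Unset Printing Implicit Defensive.

(** Write [d] for [Delta + 1] and [omega] for the biclique number, so that
    [2 * d <= 3 * omega]. The set [I] only has to be acyclic and to meet every
    biclique of size [omega]: two vertices of a biclique span a digon, hence an
    acyclic set has at most one vertex in each of them, and deleting it lowers the
    biclique number by exactly one (lemma [biclique_number_del]).

    Consider the intersection graph of the maximum bicliques. Its components
    cover pairwise disjoint sets of vertices. A vertex that lies in all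
    members of a family of maximum bicliques is joined in both directions to their
    whole union, so this union has at most [d] vertices; on the other hand Hajnal's inequality
    (lemma [hajnal_family]) says that the intersection and the union of the family
    have together at least [2 * omega] vertices. Together they give the dichotomy
    of [core_or_triple]: the bicliques of a component either have a common vertex,
    or [2 * d = 3 * omega] and the component contains a biclique [A] that meets
    two others, [B] and [Q], in disjoint sets.

    In the first case let [K] be the intersection and [U] the union of the
    bicliques of the component. One vertex of [K] hits them all, each vertex of [K]
    has at most [d - #|U|] out-neighbours outside [U], and [K] has at least
    [2 * omega - #|U|] vertices to choose from.

    In the second case put [p = omega / 2 = d / 3]. All degrees around [A] are
    exhausted by [A], [B] and [Q], which forces every biclique of the component to
    be the union of two twin classes of size [p], and every class to lie in at most
    two bicliques. So the classes form a path or a cycle in which consecutive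
    classes make up the bicliques (lemmas [path_struct] and [deg2_component]), and
    only the classes at the ends of a path have neighbours outside the component.
    If they form an odd cycle, connectedness makes this component all of [D], which
    is then the excluded digraph (lemma [cycle_iso]). Otherwise choosing every
    other class hits all bicliques, and an end class has to be used only on a path
    with an even number of classes; there either end may be used, so that one can
    choose among [2 * p] vertices, each with at most [p] out-neighbours outside
    (lemma [path_gadget]).

    It remains to make one choice in each component so that the union is acyclic.
    This is the directed version [acyclic_transversal] of Haxell's theorem on
    independent transversals, in its lopsided form: if every vertex of a class [V]
    has at most [k] out-neighbours outside [V], and at most [#|V| - k] of them,
    then some acyclic set has one vertex in each class. With [k = d - omega] both
    kinds of components satisfy this. *)

(** * Acyclic transversals *)

Section Acyclic.
Variables (T : finType) (e : rel T).

(** Acyclicity as the existence of a source in every nonempty subset: in this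
    form, to insert a vertex into an acyclic set one only has to say which vertex
    is the source, without cutting and joining paths. *)
Definition acyclic_rel (M : {set T}) :=
  forall B : {set T}, B \subset M -> B != set0 ->
  exists2 b, b \in B & forall z, z \in B -> ~~ e z b.

Lemma acyclic_rel_cycle (M : {set T}) c :
  acyclic_rel M -> c != [::] -> cycle e c -> ~~ all [in M] c.
Proof.
move=> acM nz cyc; apply/negP => /allP cM.
have [||b] := acM [set x in c].
- by apply/subsetP => x; rewrite inE => /cM.
- by case: c nz {cyc cM} => // x c _; apply/set0Pn; exists x; rewrite inE mem_head.
rewrite inE => bc /(_ (prev c b)).
by rewrite inE mem_prev bc (prev_cycle cyc bc) => /(_ isT).
Qed.

End Acyclic.

(** Fix a digraph [e] without arcs inside the fibres of [c]. The arguments below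
    add one more class [a] to a partial acyclic transversal [M], by the exchange
    argument of Haxell's theorem. Vertices [x] that one would like to put into [M]
    are collected in a list [xs], the latest at the head. What prevents [x] from
    entering [M] is a set of blockers, and the classes of the blockers are the ones
    in which the search goes on. Each new [x] receives no arc from the vertices
    collected so far or their blockers. Such a vertex exists by counting
    out-neighbours, and once it has no blockers itself, swapping it into [M]
    removes one of the earlier blockers without creating others. *)
Section Augment.

Variables (T I : finType) (e : rel T) (c : T -> I) (U : {set T}) (k : nat).

Let outs v := [set w in U | e v w].
Let fib i := [set w in U | c w == i].

Hypothesis e_class : forall v w, e v w -> c v != c w.
Hypothesis out_le : forall v, v \in U -> #|outs v| <= k.
Hypothesis out_fib : forall v, v \in U -> #|outs v| + k <= #|fib (c v)|.

(** When [xs] is inserted into a topological order of [M], these vertices are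
    forced to come after some vertex of [xs]; the others may all come first. *)
Definition reach (M : {set T}) (xs : seq T) : {set T} :=
  [set y | [exists x in xs, exists z in M,
     e x z && connect (fun u v => e u v && (v \in M)) z y]].

Lemma reach_start (M : {set T}) xs x y : x \in xs -> e x y -> y \in M -> y \in reach M xs.
Proof.
move=> xxs exy yM; rewrite inE; apply/existsP; exists x; rewrite xxs /=.
by apply/existsP; exists y; rewrite yM exy connect0.
Qed.

Lemma reach_step (M : {set T}) xs z y : z \in reach M xs -> e z y -> y \in M -> y \in reach M xs.
Proof.
rewrite !inE => /existsP[x /andP[xxs /existsP[w /and3P[wM exw wz]]]] ezy yM.
apply/existsP; exists x; rewrite xxs /=; apply/existsP; exists w.
by rewrite wM exw /=; apply: connect_trans wz _; apply: connect1; rewrite ezy.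
Qed.

Lemma reach_min (M : {set T}) xs (B : {set T}) :
  (forall x y, x \in xs -> e x y -> y \in M -> y \in B) ->
  (forall z y, z \in B -> e z y -> y \in M -> y \in B) ->
  reach M xs \subset B.
Proof.
move=> B0 B1; apply/subsetP => y; rewrite inE.
case/existsP=> x /andP[xxs /existsP[w /and3P[wM exw /connectP[q]]]].
have wB : w \in B by apply: B0 exw wM.
elim: q w wB {wM exw} => [|z q IH] w wB /= => [_ ->//|/andP[/andP[ewz zM]]].
by apply: IH; apply: B1 ewz zM.
Qed.

Lemma reach_sub M xs : reach M xs \subset M.
Proof. by apply: reach_min. Qed.

Lemma reach_mono M xs ys : {subset xs <= ys} -> reach M xs \subset reach M ys.
Proof.
move=> s; apply: reach_min => [x y /s|z y]; first exact: reach_start.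
exact: reach_step.
Qed.

(** Every cycle that [x] closes with [M] enters [x] through a blocker. Counting
    as reachable also what the older vertices [xs] reach, not only what [x] does,
    is what keeps their blockers under control when [x] enters [M] for lack of
    blockers: then no vertex reachable from [xs] sends an arc to [x]. *)
Definition blockers M x xs := [set w in reach M (x :: xs) | e w x].

Fixpoint all_blockers M xs :=
  if xs is x :: xs' then blockers M x xs' :|: all_blockers M xs' else set0.

Variable a : I.

(** Looking only into the classes [a] and [c @: all_blockers M xs] ensures that
    a candidate without blockers either covers [a] or replaces an old blocker. *)
Definition candidate M x xs :=
  [&& x \in U, c x \in a |: c @: all_blockers M xs
    & [forall z in [set y in xs] :|: all_blockers M xs, ~~ e z x]].

Fixpoint valid M xs :=
  if xs is x :: xs' then
    [&& valid M xs', candidate M x xs' & blockers M x xs' != set0]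
  else true.

Lemma all_blockers_sub M xs : all_blockers M xs \subset M.
Proof.
elim: xs => [|x xs IH] /=; first exact: sub0set.
rewrite subUset IH andbT; apply/subsetP => w; rewrite inE => /andP[wr _].
exact: subsetP (reach_sub _ _) _ wr.
Qed.

Lemma valid_size M xs : valid M xs -> size xs <= #|all_blockers M xs|.
Proof.
elim: xs => [|x xs IH] //= /and3P[/IH sz /and3P[_ _ /forall_inP dom]].
rewrite -card_gt0 => b0.
rewrite cardsU (_ : _ :&: _ = set0) ?cards0; first by lia.
apply/setP => w; rewrite !inE; apply/negP => /andP[/andP[_ ewx] wA].
by have := dom w; rewrite inE wA orbT ewx => /(_ isT).
Qed.

Lemma valid_mem M xs : valid M xs -> {subset xs <= U}.
Proof.
elim: xs => [|x xs IH] //= /and3P[v /and3P[xU _ _] _] y.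
by rewrite inE => /predU1P[->//|]; apply: IH.
Qed.

(** Otherwise the vertices [xs] and their blockers dominate all classes under
    consideration. There are at most as many vertices in [xs] as blockers; pairing
    each of them with a blocker [w], a pair dominates at most
    [k + (#|fib (c w)| - k)] vertices, so that not more vertices are dominated than
    the classes of the blockers have, and the class [a] is left over. *)
Lemma candidate_exists (M : {set T}) xs :
  M \subset U -> {in M &, injective c} -> a \in c @: U -> a \notin c @: M ->
  valid M xs -> exists x, candidate M x xs.
Proof.
move=> MU cM aU aM vxs; set W := all_blockers M xs.
have WM : W \subset M := all_blockers_sub M xs.
case: (pickP (candidate M ^~ xs)) => [x xc|none]; first by exists x.
exfalso.
have cW : {in W &, injective c}.
  by move=> x y xW yW; apply: cM; apply: (subsetP WM).
have aW : a \notin c @: W.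
  by apply: contra aM => aW; apply: subsetP (imsetS c WM) _ aW.
pose G := [set w in U | c w \in a |: c @: W].
have GN : G \subset (\bigcup_(x in [set y in xs]) outs x) :|: (\bigcup_(w in W) outs w).
  apply/subsetP => x; rewrite inE => /andP[xU xc].
  have := none x; rewrite /candidate xU xc /= => /forall_inPn[z].
  rewrite !inE negbK => /orP[zxs|zW] ezx; apply/orP; [left|right].
    by apply/bigcupP; exists z; rewrite inE ?xU.
  by apply/bigcupP; exists z => //; rewrite inE xU.
have cardG : #|G| = #|fib a| + \sum_(w in W) #|fib (c w)|.
  rewrite -(big_imset (fun i => #|fib i|)) //= -big_setU1 //=.
  rewrite -sum1dep_card (partition_big c (mem (a |: c @: W))) /=; last first.
    by move=> w /andP[].
  apply: eq_bigr => i iS; rewrite -sum1dep_card; apply: eq_bigl => w.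
  by case: eqP => [->|]; rewrite ?iS ?andbT ?andbF.
have fa : 0 < #|fib a|.
  case/imsetP: aU => x xU ->; apply/card_gt0P; exists x.
  by rewrite inE xU eqxx.
have leU (A : {set T}) : #|\bigcup_(w in A) outs w| <= \sum_(w in A) #|outs w|.
  elim/big_rec2: _ => [|w n B _ IH]; first by rewrite cards0.
  by apply: leq_trans (leq_card_setU _ _) _; rewrite leq_add2l.
have le1 : \sum_(x in [set y in xs]) #|outs x| <= size xs * k.
  apply: leq_trans (_ : \sum_(x in [set y in xs]) k <= _).
    by apply: leq_sum => x; rewrite inE => /(valid_mem vxs)/out_le.
  by rewrite sum_nat_const leq_mul2r cardsE card_size orbT.
have le3 : \sum_(w in W) #|outs w| + #|W| * k <= \sum_(w in W) #|fib (c w)|.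
  rewrite -sum_nat_const -big_split /=; apply: leq_sum => w wW.
  by apply: out_fib; apply: subsetP MU _ (subsetP WM _ wW).
have := leq_trans (subset_leq_card GN) (leq_card_setU _ _).
have := leU [set y in xs]; have := leU W.
have : size xs * k <= #|W| * k by rewrite leq_mul2r valid_size ?orbT.
lia.
Qed.

Fixpoint agree M M' xs : Prop :=
  if xs is x :: xs' then blockers M' x xs' = blockers M x xs' /\ agree M M' xs'
  else True.

(** [M'] improves on [M] if, from the oldest vertex of the list on, the blocker
    sets are unchanged up to some vertex where the set shrinks. This is the
    lexicographic order in which the exchange argument descends. *)
Fixpoint progress M M' xs : Prop :=
  if xs is x :: xs' then
    progress M M' xs' \/
    agree M M' xs' /\ blockers M' x xs' \proper blockers M x xs'
  else False.

Lemma agree_all_blockers M M' xs : agree M M' xs -> all_blockers M' xs = all_blockers M xs.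
Proof. by elim: xs => [//|x xs IH] [e1 /IH e2]; rewrite [LHS]/= e1 e2. Qed.

Lemma agree_candidate M M' x xs :
  agree M M' xs -> candidate M x xs -> candidate M' x xs.
Proof. by move=> /agree_all_blockers; rewrite /candidate => ->. Qed.

Lemma agree_valid M M' xs : agree M M' xs -> valid M xs -> valid M' xs.
Proof.
elim: xs => [//|x xs IH] [eb ag] /and3P[v cnd bn0].
by apply/and3P; split; [exact: IH|exact: agree_candidate ag cnd|rewrite eb].
Qed.

Lemma agree_progress M M' M'' xs :
  agree M M' xs -> progress M' M'' xs -> progress M M'' xs.
Proof.
elim: xs => [//|x xs IH] [eb ag] [pr|[ag' pb]]; first by left; apply: IH.
right; split; last by rewrite -eb.
elim: xs ag ag' {IH eb pb} => [//|y ys IH] [e1 a1] [e2 a2].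
by split; [rewrite e2 e1|exact: IH].
Qed.

(** A blocker [w] may disappear from several of the sets at once, and other
    blockers with it; the oldest set that changes witnesses the progress. *)
Lemma progress_intro M M' xs w :
  w \in all_blockers M xs ->
  (forall y ys, {subset y :: ys <= xs} ->
     blockers M' y ys \subset blockers M y ys :\ w) ->
  progress M M' xs.
Proof.
have aux ys : (forall y zs, {subset y :: zs <= ys} ->
     blockers M' y zs \subset blockers M y zs :\ w) ->
     agree M M' ys \/ progress M M' ys.
  elim: ys => [|y ys IH] H /=; first by left.
  have [|ag|pr] := IH; last by right; left.
    by move=> z zs s; apply: H => u /s us; rewrite inE us orbT.
  have := H y ys (fun _ h => h) => sub.
  case: (boolP (blockers M y ys \subset blockers M' y ys)) => s2.
    left; split=> //; apply/eqP; rewrite eqEsubset s2 andbT.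
    by apply: subset_trans sub (subD1set _ _).
  right; right; split=> //; rewrite properE s2 andbT.
  by apply: subset_trans sub (subD1set _ _).
elim: xs => [|x xs IH] /=; first by rewrite inE.
move=> wx H.
have H' y ys : {subset y :: ys <= xs} -> blockers M' y ys \subset blockers M y ys :\ w.
  by move=> s; apply: H => u /s us; rewrite inE us orbT.
case: (boolP (w \in all_blockers M xs)) => wA; first by left; apply: IH.
have {wx} wx : w \in blockers M x xs by move: wx; rewrite inE (negbTE wA) orbF.
have [ag|pr] := aux _ H'; last by left.
right; split=> //; have sub := H x xs (fun _ h => h).
apply/properP; split; first exact: subset_trans sub (subD1set _ _).
by exists w => //; apply/negP => /(subsetP sub); rewrite !inE eqxx.
Qed.

(** The vertices in [reach M (x :: xs)] can be put last, and [x] just before them: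
    a nonempty set has its source outside this final part if it can, and at [x]
    otherwise. *)
Lemma acyclic_add (M M' : {set T}) x xs :
  acyclic_rel e M -> M' \subset x |: M -> blockers M x xs = set0 ->
  acyclic_rel e M'.
Proof.
move=> acM M'M b0 B BM' B0; set Rx := reach M (x :: xs).
have xfree z : z \in Rx -> ~~ e z x.
  by move=> zR; apply/negP => ezx; have := in_set0 z; rewrite -b0 inE zR ezx.
have xx : ~~ e x x by apply/negP => /e_class; rewrite eqxx.
have BxM z : z \in B -> z != x -> z \in M.
  by move=> /(subsetP BM') /(subsetP M'M); rewrite !inE => /predU1P[->|//]; rewrite eqxx.
case: (boolP (x \in B)) => xB; last first.
  by apply: acM => //; apply/subsetP => z zB; apply: BxM => //; apply: contraNneq xB => <-.
(* Either [B] lies in [x] and its reachable part, with source [x], or a source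
   of the remainder of [B] is one of [B]. *)
have [B2|[b]] := set_0Vmem ((B :\ x) :\: Rx).
  exists x => // z zB; case: (eqVneq z x) => [->//|zx]; apply: xfree.
  by apply/negPn/negP => zR; have := in_set0 z; rewrite -B2 in_setD in_setD1 zR zx zB.
move=> b2.
have [||b' b'2 b'src] := acM ((B :\ x) :\: Rx).
- by apply/subsetP => z; rewrite !inE => /and3P[_ zx zB]; apply: BxM.
- by apply/set0Pn; exists b.
move: (b'2); rewrite in_setD in_setD1 => /and3P[b'R b'x b'B].
exists b' => // z zB; have b'M := BxM _ b'B b'x.
case: (eqVneq z x) => [->|zx].
  by apply: contra b'R => exb; apply: reach_start exb b'M; rewrite mem_head.
case: (boolP (z \in Rx)) => zR.
  by apply: contra b'R => ezb; apply: reach_step ezb b'M.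
by apply: b'src; rewrite in_setD in_setD1 zR zx zB.
Qed.

Variable J : {set I}.
Hypothesis aU : a \in c @: U.
Hypothesis aJ : a \notin J.

Definition partial_transversal (L : {set I}) (M : {set T}) :=
  [/\ M \subset U, {in M &, injective c}, c @: M = L & acyclic_rel e M].

(** A candidate without blockers of class [a] extends [M]. One of another class
    replaces in [M] the blocker [w] of its class. It receives no arcs from [xs]
    or from anything that [xs] reaches, so the sets reachable in the new [M] are
    contained in the old ones, and [w] is gone from them. *)
Lemma swap M x xs :
  partial_transversal J M -> valid M xs -> candidate M x xs -> blockers M x xs = set0 ->
  (exists M', partial_transversal (a |: J) M') \/
  (exists2 M', partial_transversal J M' & progress M M' xs).
Proof.
move=> [MU cM cJ acM] vxs /and3P[xU xc /forall_inP dom] b0.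
move: xc; rewrite in_setU1 => /predU1P[xa|/imsetP[w wW xw]].
  left; exists (x |: M); split.
  - by rewrite subUset sub1set xU.
  - have xM y : y \in M -> c y != c x.
      by move=> yM; apply: contraNneq aJ; rewrite xa -cJ => <-; apply: imset_f.
    move=> y z; rewrite !inE => /predU1P[->|yM] /predU1P[->|zM] //.
    + by move=> exz; move: (xM _ zM); rewrite exz eqxx.
    + by move=> exz; move: (xM _ yM); rewrite exz eqxx.
    by apply: cM.
  - by rewrite imsetU1 xa cJ.
  - exact: acyclic_add acM _ b0.
right; have wM : w \in M by apply: subsetP wW; apply: all_blockers_sub.
have otherM y : y \in M -> y != w -> c y != c x.
  by rewrite xw => yM; apply: contraNneq => cyw; apply/eqP/cM.
exists (x |: M :\ w); first split.
- by rewrite subUset sub1set xU (subset_trans (subD1set _ _)).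
- move=> y z; rewrite !inE => /predU1P[->|/andP[yw yM]] /predU1P[->|/andP[zw zM]] //.
  + by move=> exz; move: (otherM _ zM zw); rewrite exz eqxx.
  + by move=> exz; move: (otherM _ yM yw); rewrite exz eqxx.
  by apply: cM.
- by rewrite imsetU1 xw -imsetU1 setD1K.
- by apply: acyclic_add acM _ b0; apply: setUS; apply: subD1set.
apply: progress_intro wW _ => y ys s.
suff sub : reach (x |: M :\ w) (y :: ys) \subset reach M (y :: ys) :\ w.
  apply/subsetP => z /setIdP[/(subsetP sub)/setD1P[zw zR] ezy].
  by rewrite in_setD1 zw; apply/setIdP.
have notx z : z \in reach M (y :: ys) -> ~~ e z x.
  move=> zR; apply/negP => ezx; have := in_set0 z; rewrite -b0 inE ezx andbT.
  by rewrite (subsetP (reach_mono _ _) _ zR) // => u /s us; rewrite inE us orbT.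
apply: reach_min => z u.
  move=> zy ezu; rewrite !inE => /predU1P[ux|/andP[uw uM]].
    by have := dom z; rewrite !inE s // -ux ezu => /(_ isT).
  by rewrite uw; have := reach_start zy ezu uM; rewrite inE.
rewrite in_setD1 => /andP[zw zR] ezu; rewrite in_setU1 in_setD1.
case/predU1P => [ux|/andP[uw uM]]; first by have := notx _ zR; rewrite -ux ezu.
by rewrite in_setD1 uw; apply: reach_step zR ezu uM.
Qed.

(** The outer induction is on the room left in the list, whose length is at most
    the number of blockers; the inner one is on the number of blockers of the
    candidate [x] chosen next. As long as [x] has blockers, the list [x :: xs] is
    valid and can be improved; an improvement that concerns only [x] leaves fewer
    blockers to [x], and the argument is repeated with the same [x]. *)
Lemma improve n M xs :
  partial_transversal J M -> valid M xs -> #|T| < n + size xs ->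
  (exists M', partial_transversal (a |: J) M') \/
  (exists2 M', partial_transversal J M' & progress M M' xs).
Proof.
elim: n M xs => [|n IHn] M xs PM vxs szn.
  have := leq_trans (valid_size vxs) (max_card _).
  by rewrite leqNgt szn.
have [x xc] : exists x, candidate M x xs.
  by have [MU cM cJ _] := PM; apply: candidate_exists; rewrite ?cJ.
move: {2}#|_| (leqnn #|blockers M x xs|) => q.
elim: q M PM vxs xc => [|q IHq] M PM vxs xc bq.
  by apply: swap PM vxs xc _; apply/eqP; rewrite -cards_eq0 -leqn0.
have [b0|bn0] := eqVneq (blockers M x xs) set0; first exact: swap PM vxs xc b0.
have [||aug|[M' PM' /= [pr|[ag pb]]]] := IHn M (x :: xs) PM.
- by rewrite /= vxs xc.
- by rewrite /= addnS -addSn.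
- by left.
- by right; exists M'.
have [||||aug|[M'' PM'' pr]] := IHq M' => //.
- exact: agree_valid ag vxs.
- exact: agree_candidate ag xc.
- by have := proper_card pb; lia.
- by left.
by right; exists M'' => //; apply: agree_progress ag pr.
Qed.

Lemma augment M : partial_transversal J M -> exists M', partial_transversal (a |: J) M'.
Proof.
move=> PM; have lt : #|T| < #|T|.+1 + size ([::] : seq T) by rewrite addn0.
by have [|[M' _ []]] := @improve _ M [::] PM isT lt.
Qed.

End Augment.

(** A lopsided Haxell theorem for digraphs, with conditions on out-degrees
    alone. Arcs inside a class are disregarded, since a transversal contains none
    of them. *)
Theorem acyclic_transversal (T I : finType) (r : rel T) (c : T -> I)
    (U : {set T}) (k : nat) :
  (forall v, v \in U ->
    let out := #|[set w in U | r v w && (c v != c w)]| in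
    out <= k /\ out + k <= #|[set w in U | c w == c v]|) ->
  exists M : {set T}, [/\ M \subset U, {in M &, injective c}, c @: M = c @: U
    & acyclic_rel (fun v w => r v w && (c v != c w)) M].
Proof.
pose e v w := r v w && (c v != c w); move=> H.
have e_class v w : e v w -> c v != c w by case/andP.
have H1 v : v \in U -> #|[set w in U | e v w]| <= k by case/H.
have H2 v : v \in U ->
    #|[set w in U | e v w]| + k <= #|[set w in U | c w == c v]| by case/H.
have [n] := ubnP #|(c @: U) :\: set0|.
suff: forall J : {set I}, J \subset c @: U -> #|(c @: U) :\: J| < n ->
    (exists M, partial_transversal e c U J M) ->
    exists M, partial_transversal e c U (c @: U) M.
  move=> suf lt; apply: suf (sub0set _) lt _; exists set0; split.
  - exact: sub0set.
  - by move=> x y; rewrite inE.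
  - exact: imset0.
  - by move=> B; rewrite subset0 => /eqP ->; rewrite eqxx.
elim: n => // n IH J JU lt exM.
have [e0|[a]] := set_0Vmem ((c @: U) :\: J).
  suff <- : J = c @: U by [].
  by apply/eqP; rewrite eqEsubset JU -setD_eq0 e0 eqxx.
rewrite inE => /andP[aJ aU]; apply: (IH (a |: J)).
- by rewrite subUset sub1set aU.
- apply: leq_trans (_ : #|(c @: U) :\: J| <= n); last by lia.
  apply: proper_card; apply/properP; split; first by apply: setDS; apply: subsetUr.
  by exists a; rewrite !in_setD ?in_setU1 ?eqxx ?aJ.
by case: exM => M PM; apply: (augment e_class H1 H2 aU aJ PM).
Qed.

(** * Graphs of maximum degree two *)

(** A maximal path through [x0] is a whole component: an inner vertex of the path
    has its two neighbours on the path, and a neighbour of an end outside of the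
    path would extend it. The same count leaves the pair of ends as the only
    possible edge between non-consecutive vertices. *)
Lemma deg2_component (T : finType) (e : rel T) (x0 : T) :
  symmetric e -> irreflexive e ->
  (forall x y z t, e x y -> e x z -> e x t -> y != z -> (t == y) || (t == z)) ->
  exists s : seq T,
  [/\ uniq s, x0 \in s, sorted e s,
      forall y z, y \in s -> e y z -> z \in s
    & forall i j, i < size s -> j < size s -> e (nth x0 s i) (nth x0 s j) ->
      [\/ j = i.+1, i = j.+1, i = 0 /\ j = (size s).-1
        | j = 0 /\ i = (size s).-1]].
Proof.
move=> eS eI deg2.
have [N szN] : exists N, forall t : seq T, uniq t -> size t <= N.
  by exists #|T| => t /card_uniqP <-; apply: max_card.
have [s [us xs ss smax]] : exists s : seq T, [/\ uniq s, x0 \in s, sorted e s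
    & forall z, z \notin s -> ~~ sorted e (z :: s) /\ ~~ sorted e (rcons s z)].
  have : exists s, [&& uniq s, x0 \in s & sorted e s] by exists [:: x0]; rewrite mem_head.
  case=> s; have [m] := ubnP (N - size s); elim: m s => // m IH s lt /and3P[us xs ss].
  have grow z (t : seq T) : z \notin s -> perm_eq t (z :: s) -> sorted e t ->
      exists s : seq T, [/\ uniq s, x0 \in s, sorted e s
    & forall z, z \notin s -> ~~ sorted e (z :: s) /\ ~~ sorted e (rcons s z)].
    move=> zs pt st; have ut : uniq t by rewrite (perm_uniq pt) /= zs.
    apply: (IH t); last by rewrite ut st (perm_mem pt) inE xs orbT.
    have := szN t ut; rewrite (perm_size pt) /=; move: lt; move: (size s) => k; clear; lia.
  case: (pickP (fun z => (z \notin s) && (sorted e (z :: s) || sorted e (rcons s z)))).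
    move=> z /andP[zs /orP[st|st]]; first exact: (grow z _ zs (perm_refl _) st).
    by apply: (grow z _ zs _ st); rewrite perm_rcons.
  move=> none; exists s; split=> // z zs; have /negbT := none z.
  by rewrite zs /= negb_or => /andP[-> ->].
set m := size s.
have step i : i.+1 < m -> e (nth x0 s i) (nth x0 s i.+1).
  by move=> lt; apply: (sortedP x0 ss).
have inj i j : i < m -> j < m -> nth x0 s i = nth x0 s j -> i = j.
  by move=> im jm /eqP; rewrite nth_uniq // => /eqP.
have mem i : i < m -> nth x0 s i \in s by apply: mem_nth.
have inner i z : 0 < i -> i.+1 < m -> e (nth x0 s i) z ->
    z = nth x0 s i.-1 \/ z = nth x0 s i.+1.
  case: i => // i _ lt ez.
  have /orP[/eqP|/eqP] : (z == nth x0 s i) || (z == nth x0 s i.+2); [|by left|by right].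
  apply: deg2 ez _; [by rewrite eS; apply: step; lia|exact: step|].
  by apply/eqP => /inj; lia.
exists s; split=> //.
  move=> y z ys eyz; apply/negPn/negP => zs.
  have [n1 n2] := smax z zs.
  move: ys eyz => /(nthP x0)[i im <-] ez; have {}im : i < m := im.
  have [i0|i0] := posnP i.
    move: n1; case: s ss i0 ez {us xs smax zs n2 m step inj mem inner im} => [|y0 s] //= p -> /=.
    by rewrite eS => ->; rewrite p.
  have [il|il] := ltnP i.+1 m.
    by case: (inner i z i0 il ez) => zE; move: zs; rewrite zE mem //; lia.
  move: ez n2; have -> : i = m.-1 by lia.
  rewrite /m nth_last; case: s ss {us xs smax zs n1 m step inj mem inner im il} => //= y0 s p ez.
  by rewrite rcons_path p ez.
move=> i j im jm eij.
have inner' k l : 0 < k -> k.+1 < m -> l < m -> e (nth x0 s k) (nth x0 s l) ->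
   l = k.+1 \/ k = l.+1.
  move=> k0 km lm /(inner _ _ k0 km)[] /inj => [h|h]; [right|left]; last exact: h.
  by rewrite h ?prednK //; lia.
have ij : i != j by apply: contraTneq eij => ->; rewrite eI.
have [i0|i0] := posnP i.
  have [jl|jl] := ltnP j.+1 m; last by constructor 3; lia.
  by have [] := inner' j i _ jl im; rewrite 1?eS //; [lia|constructor 2|constructor 1].
have [il|il] := ltnP i.+1 m.
  by have [] := inner' i j i0 il jm eij; [constructor 1|constructor 2].
have [j0|j0] := posnP j; first by constructor 4; lia.
have jl : j.+1 < m by lia.
by have [] := inner' j i j0 jl im; rewrite 1?eS //; [constructor 2|constructor 1].
Qed.

(** * Maximum bicliques *)

(* Otherwise [arc] would denote the arcs of a cyclic sequence. *)
Local Notation arc := Defs.arc.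

Lemma bicliqueP (D : digraph) (A : {set D}) :
  reflect {in A &, forall u v, u != v -> arc u v /\ arc v u} (biclique A).
Proof.
apply: (iffP forall_inP) => [H u v uA vA uv|H u uA].
  by have /forall_inP/(_ v vA)/implyP/(_ uv)/andP := H u uA.
by apply/forall_inP => v vA; apply/implyP => /(H u v uA vA) [-> ->].
Qed.

Section Bicliques.
Variable D : digraph.

Let omega := biclique_number D.
Hypothesis omega_gt0 : 0 < omega.

Implicit Types (A B Q R K U X Y Z : {set D}) (u v w x y z : D).

Lemma card_biclique_le A : biclique A -> #|A| <= omega.
Proof. by move=> bA; apply: (bigmax_sup A). Qed.

Definition max_biclique A := biclique A && (#|A| == omega).

Lemma max_biclique_card A : max_biclique A -> #|A| = omega.
Proof. by case/andP => _ /eqP. Qed.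

Lemma max_biclique_arc A u v : max_biclique A -> u \in A -> v \in A -> u != v ->
  arc u v /\ arc v u.
Proof. by case/andP => /bicliqueP H _; apply: H. Qed.

Lemma max_biclique_sub A B : max_biclique A -> max_biclique B -> A \subset B -> A = B.
Proof.
move=> mA mB AB; apply/eqP; rewrite eqEcard AB.
by rewrite (max_biclique_card mA) (max_biclique_card mB) leqnn.
Qed.

Lemma max_biclique_exists : exists A, max_biclique A.
Proof.
have b0 : biclique (set0 : {set D}) by apply/bicliqueP => u v; rewrite inE.
have cpos : 0 < #|[pred A : {set D} | biclique A]| by apply/card_gt0P; exists set0; rewrite inE.
have [A bA eA] := eq_bigmax_cond (fun A : {set D} => #|A|) cpos.
rewrite inE in bA; exists A; rewrite /max_biclique bA /= /omega /biclique_number -eA.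
by apply/eqP; apply: eq_bigl => B; rewrite inE.
Qed.

(** The invariant behind Hajnal's inequality, where [K] and [U] stand for the
    intersection and the union of a family of maximum bicliques. *)
Definition hajnal K U :=
  [/\ K \subset U, forall u v, u \in K -> v \in U -> u != v -> arc u v /\ arc v u
    & 2 * omega <= #|K| + #|U|].

Lemma hajnal1 A : max_biclique A -> hajnal A A.
Proof.
move=> mA; split=> //; first by move=> u v; apply: max_biclique_arc.
by rewrite (max_biclique_card mA) mul2n addnn.
Qed.

(** [K :|: (A :&: U)] is a biclique, so it has at most [omega] vertices; hence
    adding [A] to the family costs the intersection no more than it brings to the
    union. *)
Lemma hajnalS K U A : hajnal K U -> max_biclique A -> hajnal (A :&: K) (A :|: U).
Proof.
move=> [KU join le] mA; split.
- exact: subset_trans (subsetIr _ _) (subset_trans KU (subsetUr _ _)).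
- move=> u v /setIP[uA uK] /setUP[vA|vU] uv; first exact: max_biclique_arc mA _ _ uv.
  exact: join uv.
have bX : biclique (K :|: (A :&: U)).
  apply/bicliqueP => u v /setUP[uK|/setIP[uA uU]] /setUP[vK|/setIP[vA vU]] uv.
  - exact: join uK (subsetP KU _ vK) uv.
  - exact: join uv.
  - by rewrite eq_sym in uv; have [] := join _ _ vK uU uv.
  - exact: max_biclique_arc mA _ _ uv.
have := card_biclique_le bX; rewrite cardsU.
have -> : K :&: (A :&: U) = A :&: K by rewrite setICA (setIidPl KU).
have := cardsU A U; have := max_biclique_card mA.
have : #|A :&: U| <= #|A| by apply: subset_leq_card (subsetIl _ _).
have : #|A :&: K| <= #|K| by apply: subset_leq_card (subsetIr _ _).
rewrite -/omega; lia.
Qed.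

Lemma hajnal_family (F : {set {set D}}) : F != set0 -> (forall A, A \in F -> max_biclique A) ->
  hajnal (\bigcap_(A in F) A) (cover F).
Proof.
case/set0Pn=> A0 A0F Fm; rewrite /cover -!big_enum.
have sF A : A \in enum F -> max_biclique A by rewrite mem_enum; apply: Fm.
suff /(_ (enum F) sF) : forall s, (forall A, A \in s -> max_biclique A) ->
   hajnal (A0 :&: \bigcap_(A <- s) A) (A0 :|: \bigcup_(A <- s) A).
  have -> : A0 :&: \bigcap_(A <- enum F) A = \bigcap_(A <- enum F) A.
    by apply/setIidPr; rewrite big_enum; apply: bigcap_inf.
  have -> // : A0 :|: \bigcup_(A <- enum F) A = \bigcup_(A <- enum F) A.
  by apply/setUidPr; rewrite big_enum; apply: (bigcup_max A0).
elim=> [|A s IH] ms; first by rewrite !big_nil setIT setU0; apply: hajnal1; apply: Fm.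
rewrite !big_cons setICA setUCA; apply: hajnalS; last by apply: ms; rewrite mem_head.
by apply: IH => B Bs; apply: ms; rewrite inE Bs orbT.
Qed.

Definition meets A B := [&& max_biclique A, max_biclique B & A :&: B != set0].

Lemma meets_sym : symmetric meets.
Proof. by move=> A B; rewrite /meets setIC andbCA. Qed.

Definition component A := [set B | connect meets A B].

Lemma component_max_biclique A B : max_biclique A -> B \in component A -> max_biclique B.
Proof.
move=> mA; rewrite inE => /connectP[p]; elim: p A mA => [|C p IH] A mA /=.
  by move=> _ ->.
by case/andP => /and3P[_ mC _]; apply: IH.
Qed.

Lemma component_refl A : A \in component A. Proof. by rewrite inE connect0. Qed.

Lemma component_eq A B : B \in component A -> component B = component A.
Proof.
rewrite inE => cAB; apply/setP => C; rewrite !inE.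
by rewrite (same_connect (sym_connect_sym meets_sym) cAB).
Qed.

Lemma component_meets A B C : B \in component A -> max_biclique B -> max_biclique C ->
  B :&: C != set0 -> C \in component A.
Proof.
rewrite !inE => cAB mB mC BC; apply: connect_trans cAB _.
by apply: connect1; rewrite /meets mB mC.
Qed.

Lemma component_ind A (P : {set D} -> Prop) : P A ->
  (forall B C, P B -> max_biclique B -> max_biclique C -> B :&: C != set0 -> P C) ->
  forall B, B \in component A -> P B.
Proof.
move=> PA step B; rewrite inE => /connectP[p]; elim: p A PA => [|C p IH] A PA /=.
  by move=> _ ->.
by case/andP => /and3P[mA mC hAC]; apply: IH; apply: step hAC.
Qed.

(** The upper bound holds because no maximum biclique survives, the lower bound
    because a digon cannot lie inside the acyclic set [I], so that a maximum
    biclique loses at most one vertex. *)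
Lemma biclique_number_del I : acyclic_rel (@Defs.arc D) I ->
  (forall R, max_biclique R -> I :&: R != set0) ->
  biclique_number (del_vertices I) = omega.-1.
Proof.
move=> acI hit; apply/eqP; rewrite eqn_leq; apply/andP; split.
  apply/bigmax_leqP => A bA; pose A' := val @: A.
  have cA' : #|A'| = #|A| by apply: card_imset val_inj.
  have bA' : biclique A'.
    apply/bicliqueP => _ _ /imsetP[u uA ->] /imsetP[v vA ->] uv.
    by move/bicliqueP: bA; apply=> //; apply: contraNneq uv => ->.
  have le := card_biclique_le bA'; rewrite -cA' -ltnS prednK // ltn_neqAle le andbT.
  apply/negP => eA; have mA' : max_biclique A' by rewrite /max_biclique bA'.
  have /set0Pn[x /setIP[xI /imsetP[u uA xu]]] := hit _ mA'.
  by have := valP u; rewrite inE -xu xI.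
have [A mA] := max_biclique_exists.
have AI1 : #|A :&: I| <= 1.
  rewrite leqNgt; apply/negP => /card_gt1P[u [v [/setIP[uA uI] /setIP[vA vI] uv]]].
  have [a1 a2] := max_biclique_arc mA uA vA uv.
  have [||b] := acI [set u; v].
  - by rewrite subUset !sub1set uI.
  - by apply/set0Pn; exists u; rewrite !inE eqxx.
  rewrite !inE => /orP[] /eqP -> src.
    by have := src v; rewrite !inE eqxx orbT a2 => /(_ isT).
  by have := src u; rewrite !inE eqxx a1 => /(_ isT).
pose A' := [set u : del_vertices I | val u \in A].
have bA' : biclique A'.
  apply/bicliqueP => u v; rewrite !inE => uA vA uv.
  by apply: max_biclique_arc mA uA vA _; apply: contraNneq uv => /val_inj ->.
have AA' : A :\: I \subset val @: A'.
  apply/subsetP => x /setDP[xA xI]; have xI' : x \in ~: I by rewrite inE.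
  by apply/imsetP; exists (Sub x xI' : del_vertices I); rewrite ?inE ?SubK.
apply: (@leq_trans #|A'|); last exact: (bigmax_sup A').
rewrite -(card_imset _ val_inj); apply: leq_trans (subset_leq_card AA').
by rewrite cardsD (max_biclique_card mA); lia.
Qed.

(** * Components whose bicliques share a vertex *)

Variable d : nat.
Hypothesis out_lt : forall v : D, outdeg v < d.
Hypothesis in_lt : forall v : D, indeg v < d.
Hypothesis omega_ge : 2 * d <= 3 * omega.

Definition out_nbhd v := [set w | (w == v) || arc v w].
Definition in_nbhd v := [set w | (w == v) || arc w v].

Lemma card_out_nbhd v : #|out_nbhd v| <= d.
Proof.
have -> : out_nbhd v = v |: [set w | arc v w] by apply/setP => w; rewrite !inE.
by rewrite cardsU1; have := out_lt v; rewrite /outdeg; case: (_ \notin _); lia.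
Qed.

Lemma card_in_nbhd v : #|in_nbhd v| <= d.
Proof.
have -> : in_nbhd v = v |: [set w | arc w v] by apply/setP => w; rewrite !inE.
by rewrite cardsU1; have := in_lt v; rewrite /indeg; case: (_ \notin _); lia.
Qed.

Lemma max_biclique_sub_out A v : max_biclique A -> v \in A -> A \subset out_nbhd v.
Proof.
move=> mA vA; apply/subsetP => w wA; rewrite inE; case: (eqVneq w v) => //= wv.
by case: (max_biclique_arc mA wA vA wv).
Qed.

Lemma max_biclique_sub_in A v : max_biclique A -> v \in A -> A \subset in_nbhd v.
Proof.
move=> mA vA; apply/subsetP => w wA; rewrite inE; case: (eqVneq w v) => //= wv.
by case: (max_biclique_arc mA wA vA wv).
Qed.

(** When [2 * d = 3 * omega], no maximum biclique but [B] and [Q] meets [A]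
    without being [A], see [triple_only]. *)
Definition triple A B Q := [/\ [/\ max_biclique A, max_biclique B & max_biclique Q],
  A :&: B != set0, A :&: Q != set0 & A :&: B :&: Q = set0].

Lemma triple_sym A B Q : triple A B Q -> triple A Q B.
Proof. by case=> [[mA mB mQ] AB AQ e]; split=> //; rewrite setIAC. Qed.

(** When [2 * d = 3 * omega], this is [omega / 2] as well as [d / 3]. *)
Let p := d - omega.

Lemma inter_card A B : max_biclique A -> max_biclique B -> A :&: B != set0 ->
  2 * omega - d <= #|A :&: B|.
Proof.
move=> mA mB /set0Pn[x /setIP[xA xB]].
have [_ _] := hajnalS (hajnal1 mB) mA.
have : #|A :|: B| <= d.
  apply: leq_trans (card_out_nbhd x); apply: subset_leq_card.
  by rewrite subUset !max_biclique_sub_out.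
by lia.
Qed.

(** Take a vertex [v] of the component in as many bicliques as possible. If some
    biclique of the component avoids [v], then one of them, [Q], meets a biclique
    [A] through [v], and by the choice of [v] no vertex lies in [Q] and in all
    bicliques through [v]. Hajnal's inequality for these and [Q] leaves no slack:
    [2 * d = 3 * omega], and [Q] meets the union of the bicliques through [v] only
    inside [A]. Any biclique [B] through [v] other than [A] is then disjoint from
    [A :&: Q]: the closed neighbourhood of a vertex of [A :&: B :&: Q] would be
    [A :|: Q], so [B] would be contained in [A]. *)
Lemma core_or_triple A0 : max_biclique A0 ->
  (exists v, forall B, B \in component A0 -> v \in B) \/
  (2 * d = 3 * omega /\ exists A B Q, A \in component A0 /\ triple A B Q).
Proof.
move=> mA0.
pose F v := [set B | max_biclique B && (v \in B)].
have Fm v B : B \in F v -> max_biclique B by rewrite inE => /andP[].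
have Fv v B : B \in F v -> v \in B by rewrite inE => /andP[].
have /card_gt0P[v0 v0A] : 0 < #|A0| by rewrite (max_biclique_card mA0).
have v0c : v0 \in cover (component A0) by apply/bigcupP; exists A0; rewrite ?component_refl.
case: (arg_maxnP (fun v => #|F v|) v0c) => v /bigcupP[A1 A1c vA1] vmax.
have mA1 := component_max_biclique mA0 A1c.
have A1F : A1 \in F v by rewrite inE mA1.
have Fc B : B \in F v -> B \in component A0.
  move=> BF; apply: component_meets A1c mA1 (Fm _ _ BF) _.
  by apply/set0Pn; exists v; rewrite inE vA1 (Fv _ _ BF).
case: (pickP (fun AQ : {set D} * {set D} =>
   [&& AQ.1 \in F v, AQ.2 \notin F v, max_biclique AQ.2 & AQ.1 :&: AQ.2 != set0]))
  => [[A Q] /= /and4P[AF QF mQ AQ]|none]; last first.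
  left; exists v => B; rewrite -(component_eq A1c) => Bc; apply: Fv.
  apply: (@component_ind A1 (fun B => B \in F v) A1F _ _ Bc) => B1 C BF mB mC BC.
  apply/negPn/negP => CF.
  by have := none (B1, C); rewrite /= BF CF mC BC.
right; have mA := Fm _ _ AF.
have F0 : F v != set0 by apply/set0Pn; exists A.
have hF := hajnal_family F0 (Fm v).
set K := \bigcap_(A in F v) A in hF; set U := cover (F v) in hF.
have QK0 : Q :&: K = set0.
  apply/setP => z; rewrite in_set0; apply/negP => /setIP[zQ /bigcapP zK].
  have zc : z \in cover (component A0) by apply/bigcupP; exists A; [exact: Fc|exact: zK].
  have := vmax z zc; rewrite /= leqNgt => /negP; apply; apply: proper_card.
  apply/properP; split; last by exists Q => //; rewrite inE mQ.
  by apply/subsetP => B BF; rewrite inE (Fm _ _ BF) zK.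
have [_ _] := hajnalS hF mQ; rewrite QK0 cards0 add0n => leQU.
have Ud : #|U| <= d.
  apply: leq_trans (card_out_nbhd v); apply: subset_leq_card; apply/bigcupsP => B BF.
  exact: max_biclique_sub_out (Fm _ _ BF) (Fv _ _ BF).
have QAU : Q :&: A \subset Q :&: U by apply: setIS; apply: (bigcup_max A).
have leQA : 2 * omega - d <= #|Q :&: A| by apply: inter_card; rewrite // setIC.
have leQAU := subset_leq_card QAU.
have leUQ : #|Q :&: U| <= #|Q| by apply: subset_leq_card (subsetIl _ _).
have cQ := max_biclique_card mQ.
have [tight leUA leUp] : [/\ 2 * d = 3 * omega, #|Q :&: U| <= #|Q :&: A|
    & #|Q :&: U| <= d - omega].
  move: omega_ge leQU Ud leQA leQAU leUQ; rewrite cardsU cQ.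
  move: #|U| #|Q :&: U| #|Q :&: A| omega => u qu qa w; clear => *; split; lia.
split=> //.
have eQU : Q :&: A = Q :&: U by apply/eqP; rewrite eqEcard QAU.
have [B BF BA] : exists2 B, B \in F v & B != A.
  case: (pickP (fun B => (B \in F v) && (B != A))) => [B /andP[]|noB]; first by exists B.
  case/set0Pn: AQ => z /setIP[zA zQ]; have := in_set0 z; rewrite -QK0 inE zQ /=.
  move/negP; case; apply/bigcapP => B BF.
  by have := noB B; rewrite BF /= => /negbFE/eqP ->.
have mB := Fm _ _ BF.
exists A, B, Q; split; first exact: Fc.
split=> //; first by apply/set0Pn; exists v; rewrite inE !Fv.
apply/setP => w; rewrite in_set0; apply/negP => /setIP[/setIP[wA wB] wQ].
have eNp : A :|: Q = out_nbhd w.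
  apply/eqP; rewrite eqEcard subUset !max_biclique_sub_out //= cardsU (max_biclique_card mA) cQ.
  apply: leq_trans (card_out_nbhd w) _; rewrite setIC eQU.
  by move: tight leUp; move: #|_| omega => qu w'; clear; lia.
case/eqP: BA; apply: max_biclique_sub => //; apply/subsetP => x xB.
have : x \in A :|: Q by rewrite eNp (subsetP (max_biclique_sub_out mB wB)).
case/setUP => // xQ; have : x \in Q :&: U by rewrite inE xQ; apply/bigcupP; exists B.
by rewrite -eQU inE => /andP[].
Qed.

(** [S] is what the component [C] contributes once [v] has been chosen in it.
    All vertices of [S] but [v] receive no arc from outside the component, so only
    [v] can be involved in a cycle through several components. *)
Definition picks (C : {set {set D}}) v (S : {set D}) :=
  [/\ S \subset cover C, forall R, R \in C -> S :&: R != set0,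
      forall u w, u \in S -> w \in S -> ~~ arc u w
    & forall u w, u \in S -> u != v -> arc w u -> w \in cover C].

(** The degree conditions are those of [acyclic_transversal] for [V] as a class
    and [k := p], as the vertices chosen in other components lie outside
    [cover C]. *)
Definition gadget (C : {set {set D}}) (V : {set D}) (g : D -> {set D}) :=
  [/\ V != set0, V \subset cover C,
      forall v, v \in V -> let out := #|[set w | arc v w] :\: cover C| in
        out <= p /\ out + p <= #|V|
    & forall v, v \in V -> picks C v (g v)].

Lemma out_cover A (W : {set D}) v : v \in A -> max_biclique A -> A \subset W ->
  #|[set w | arc v w] :\: W| <= p.
Proof.
move=> vA mA AW; apply: (@leq_trans #|out_nbhd v :\: A|).
  apply: subset_leq_card; apply/subsetP => w; rewrite !inE => /andP[wW ->].
  by rewrite orbT andbT; apply: contra wW; apply: (subsetP AW).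
rewrite cardsD (setIidPr (max_biclique_sub_out mA vA)) (max_biclique_card mA).
by rewrite leq_sub2r ?card_out_nbhd.
Qed.

(** For a vertex [v] of the intersection [K], the union [U] is contained in the
    closed out-neighbourhood of [v]. So [v] has at most [d - #|U| <= d - omega]
    out-neighbours outside, and [(d - #|U|) + (d - omega) <= 2 * omega - #|U| <= #|K|]
    by [2 * d <= 3 * omega] and Hajnal's inequality. *)
Lemma core_gadget A0 v0 : max_biclique A0 -> (forall B, B \in component A0 -> v0 \in B) ->
  exists V g, gadget (component A0) V g.
Proof.
move=> mA0 v0C; set C := component A0 in v0C *.
have mC B : B \in C -> max_biclique B by apply: component_max_biclique.
have C0 : C != set0 by apply/set0Pn; exists A0; apply: component_refl.
have [KU join le] := hajnal_family C0 mC.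
set K := \bigcap_(A in C) A in KU join le; set U := cover C in KU join le.
have A0U : A0 \subset U by apply: (bigcup_max A0) => //; apply: component_refl.
exists K, (fun v => [set v]); split=> //.
- by apply/set0Pn; exists v0; apply/bigcapP.
- move=> v vK /=.
  have UN : U \subset out_nbhd v.
    apply/subsetP => w wU; rewrite inE; case: (eqVneq w v) => //= wv.
    by rewrite eq_sym in wv; have [] := join _ _ vK wU wv.
  have : #|[set w | arc v w] :\: U| <= d - #|U|.
    apply: leq_trans (leq_sub2r _ (card_out_nbhd v)); rewrite -{2}(setIidPr UN) -cardsD.
    by apply: subset_leq_card; apply/subsetP => w; rewrite !inE => /andP[-> ->]; rewrite orbT.
  have := subset_leq_card A0U; rewrite (max_biclique_card mA0).
  have : #|U| <= d by apply: leq_trans (card_out_nbhd v); apply: subset_leq_card.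
  move: le omega_ge; rewrite /p.
  move: #|K| #|U| #|_ :\: _| omega => a b c w; clear => *; split; lia.
- move=> v vK; split.
  + by rewrite sub1set (subsetP KU).
  + move=> R RC; apply/set0Pn; exists v; rewrite !inE eqxx /=.
    by move/bigcapP: vK; apply.
  + by move=> u w /set1P -> /set1P ->; rewrite arc_irr.
  + by move=> u w /set1P ->; rewrite eqxx.
Qed.

(** * Components whose bicliques share no vertex *)

Section Tight.
Hypothesis tight : 2 * d = 3 * omega.

Definition twins x := [set w | [forall R, max_biclique R ==> ((x \in R) == (w \in R))]].

Definition twin_class X := (#|X| == p) && [exists x in X, X == twins x].

Lemma twins_eq x w : w \in twins x -> twins w = twins x.
Proof.
rewrite inE => /forallP xw; apply/setP => y; rewrite !inE.
by apply: eq_forallb => R; case: (boolP (max_biclique R)) (xw R) => //= mR /eqP ->.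
Qed.

Lemma twin_class_twins X x : twin_class X -> x \in X -> X = twins x.
Proof. by case/andP => _ /exists_inP[y yX /eqP XE]; rewrite XE => /twins_eq ->. Qed.

Lemma twin_class_eq X Y x : twin_class X -> twin_class Y -> x \in X -> x \in Y -> X = Y.
Proof. by move=> cX cY xX xY; rewrite (twin_class_twins cX xX) (twin_class_twins cY xY). Qed.

Lemma twin_class_disj X Y : twin_class X -> twin_class Y -> X != Y -> X :&: Y = set0.
Proof.
move=> cX cY nXY; apply/setP => x; rewrite in_set0; apply/negP => /setIP[xX xY].
by move: nXY; rewrite (twin_class_eq cX cY xX xY) eqxx.
Qed.

Lemma twin_class_card X : twin_class X -> #|X| = p.
Proof. by case/andP => /eqP. Qed.


Lemma omegaE : omega = 2 * p. Proof. by have := tight; rewrite /p; lia. Qed.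
Lemma dE : d = 3 * p. Proof. by have := tight; rewrite /p; lia. Qed.
Lemma p_gt0 : 0 < p. Proof. by have := omegaE; have := omega_gt0; lia. Qed.

Lemma twin_class_intro X : #|X| = p ->
  (forall R x, max_biclique R -> x \in X -> x \in R -> X \subset R) ->
  (forall w, w \notin X ->
    exists2 R, max_biclique R & forall x, x \in X -> (x \in R) != (w \in R)) ->
  twin_class X.
Proof.
move=> Xp Xsub Xsep; rewrite /twin_class Xp eqxx /=.
have /card_gt0P[x xX] : 0 < #|X| by rewrite Xp p_gt0.
apply/exists_inP; exists x => //; apply/eqP/setP => w; rewrite inE.
apply/idP/forallP => [wX R|H].
  apply/implyP => mR; apply/eqP; apply/idP/idP => [xR|wR].
    exact: (subsetP (Xsub R x mR xX xR)).
  exact: (subsetP (Xsub R w mR wX wR)).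
apply/negPn/negP => /Xsep[R mR /(_ x xX)].
by have := H R; rewrite mR /= => ->.
Qed.

Lemma twin_class_witness X : twin_class X -> exists x, x \in X.
Proof. by move=> cX; apply/card_gt0P; rewrite (twin_class_card cX) p_gt0. Qed.

(** Bicliques that meet in just [p] vertices have [d] vertices in their union,
    which exhausts the degrees of the common vertices. *)
Lemma nbhd_union A B x : max_biclique A -> max_biclique B -> #|A :&: B| = p -> x \in A :&: B ->
  out_nbhd x = A :|: B /\ in_nbhd x = A :|: B.
Proof.
move=> mA mB cAB /setIP[xA xB].
have cU : #|A :|: B| = d.
  by rewrite cardsU (max_biclique_card mA) (max_biclique_card mB) cAB omegaE dE; lia.
split; apply/esym/eqP; rewrite eqEcard cU subUset.
  by rewrite !max_biclique_sub_out ?card_out_nbhd.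
by rewrite !max_biclique_sub_in ?card_in_nbhd.
Qed.

(** Both intersections have at least [p] vertices, are disjoint, and lie in [A],
    which has [2 * p]. Then Hajnal's inequality for the three bicliques leaves no
    room for common vertices of [B] and [Q]. *)
Lemma triple_card A B Q : triple A B Q ->
  [/\ #|A :&: B| = p, #|A :&: Q| = p, (A :&: B) :|: (A :&: Q) = A & B :&: Q = set0].
Proof.
case=> [[mA mB mQ] AB AQ ABQ].
have i1 := inter_card mA mB AB; have i2 := inter_card mA mQ AQ.
have dis : (A :&: B) :&: (A :&: Q) = set0 by rewrite setIACA setIid setIA.
have sub : (A :&: B) :|: (A :&: Q) \subset A by rewrite subUset !subsetIl.
have cU : #|(A :&: B) :|: (A :&: Q)| = #|A :&: B| + #|A :&: Q|.
  by rewrite cardsU dis cards0 subn0.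
have := subset_leq_card sub; rewrite cU (max_biclique_card mA) => le.
have [eo ed] := (omegaE, dE).
have c1 : #|A :&: B| = p by lia.
have c2 : #|A :&: Q| = p by lia.
have eA : (A :&: B) :|: (A :&: Q) = A.
  by apply/eqP; rewrite eqEcard sub cU (max_biclique_card mA); lia.
split=> //; have [_ _] := hajnalS (hajnalS (hajnal1 mQ) mB) mA.
rewrite setIA ABQ cards0 add0n cardsU setIUr eA cardsU.
rewrite (max_biclique_card mA) (max_biclique_card mB) (max_biclique_card mQ) => h.
have : #|B :&: Q| <= #|B| by apply: subset_leq_card (subsetIl _ _).
by rewrite (max_biclique_card mB) => h2; apply: cards0_eq; lia.
Qed.

(** [R] lies in the neighbourhood [A :|: B] of [x]. If [R] also contains a vertex
    of [A :&: Q], it lies in [A :|: Q] too, hence in [A], since [B] and [Q] are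
    disjoint; otherwise it lies in [B]. *)
Lemma triple_only1 A B Q R x : triple A B Q -> max_biclique R -> x \in R -> x \in A :&: B ->
  R = A \/ R = B.
Proof.
move=> t mR xR xAB; have [c1 c2 eA BQ] := triple_card t.
case: t => [[mA mB mQ] _ _ _].
have [Nx _] := nbhd_union mA mB c1 xAB.
have RAB : R \subset A :|: B by rewrite -Nx; apply: max_biclique_sub_out.
case: (set_0Vmem (R :&: (A :&: Q))) => [R0|[u /setIP[uR uAQ]]].
  right; apply: max_biclique_sub => //; apply/subsetP => y yR.
  case/setUP: (subsetP RAB _ yR) => // yA.
  move: yA; rewrite -eA => /setUP[/setIP[]//|yAQ].
  by have := in_set0 y; rewrite -R0 inE yR yAQ.
left; apply: max_biclique_sub => //; apply/subsetP => y yR.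
have [Nu _] := nbhd_union mA mQ c2 uAQ.
have : y \in A :|: Q by rewrite -Nu (subsetP (max_biclique_sub_out mR uR)).
case/setUP: (subsetP RAB _ yR) => // yB /setUP[//|yQ].
by have := in_set0 y; rewrite -BQ inE yB yQ.
Qed.

Lemma triple_only A B Q R x : triple A B Q -> max_biclique R -> x \in R -> x \in A ->
  [\/ R = A, R = B | R = Q].
Proof.
move=> t mR xR xA; have [_ _ eA _] := triple_card t.
move: xA; rewrite -{1}eA => /setUP[xAB|xAQ].
  by case: (triple_only1 t mR xR xAB); [constructor 1|constructor 2].
by case: (triple_only1 (triple_sym t) mR xR xAQ); [constructor 1|constructor 3].
Qed.

(** The edges of the path or cycle that describes the component. *)
Definition link X Y := [&& twin_class X, twin_class Y, X :&: Y == set0 & max_biclique (X :|: Y)].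

Lemma link_sym : symmetric link.
Proof. by move=> X Y; rewrite /link setIC setUC andbCA. Qed.

Lemma link_irr : irreflexive link.
Proof.
move=> X; apply/negP => /and4P[/twin_class_card cX _]; rewrite setIid => /eqP X0.
by move: p_gt0; rewrite -cX X0 cards0.
Qed.

Lemma twin_class_center A B Q : triple A B Q -> twin_class (A :&: B).
Proof.
move=> t; have [c1 _ _ _] := triple_card t; have [[mA mB _] _ _ _] := t.
apply: twin_class_intro => // [R x mR xAB xR|w].
  by case: (triple_only1 t mR xR xAB) => ->; rewrite ?subsetIl ?subsetIr.
rewrite inE negb_and => /orP[wA|wB]; [exists A|exists B] => // x /setIP[xA xB].
  by rewrite xA (negbTE wA).
by rewrite xB (negbTE wB).
Qed.

Lemma link_center A B Q : triple A B Q -> link (A :&: B) (A :&: Q).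
Proof.
move=> t; have [_ _ eA _] := triple_card t; have [[mA mB _] _ _ ABQ] := t.
apply/and4P; split; [exact: twin_class_center t| | |by rewrite eA].
  exact: twin_class_center (triple_sym t).
by rewrite setIACA setIid setIA ABQ.
Qed.

(** A biclique [R] through [x] that meets [B] outside [A] and is not [B] is
    disjoint from [A] by [triple_only]; then [B] is the centre of a triple with [A]
    and [R], so that [R] contains all of [B :\: A]. *)
Lemma twin_class_side A B Q : triple A B Q -> twin_class (B :\: A).
Proof.
move=> t; have [c1 _ _ BQ] := triple_card t; have [[mA mB mQ] AB _ _] := t.
apply: twin_class_intro => [|R x mR /setDP[xB xA] xR|w].
- by rewrite cardsD setIC c1 (max_biclique_card mB) omegaE; lia.
- case: (set_0Vmem (R :&: A)) => [RA0|[u /setIP[uR uA]]].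
    have t' : triple B A R.
      split=> //; [by rewrite setIC| |by rewrite -setIA (setIC A) RA0 setI0].
      by apply/set0Pn; exists x; rewrite inE xB.
    have [_ _ eB _] := triple_card t'.
    apply/subsetP => y /setDP[yB yA]; move: yB.
    by rewrite -{1}eB !inE (negbTE yA) andbF /= => /andP[].
  case: (triple_only t mR uR uA) => RE; first by rewrite -RE xR in xA.
    by rewrite RE subsetDl.
  by have := in_set0 x; rewrite -BQ -RE inE xB xR.
rewrite inE negb_and negbK => /orP[wA|wB]; [exists A|exists B] => // x /setDP[xB xA].
  by rewrite wA (negbTE xA).
by rewrite xB (negbTE wB).
Qed.

Lemma link_side A B Q : triple A B Q -> link (A :&: B) (B :\: A).
Proof.
move=> t; have [[mA mB _] _ _ _] := t.
apply/and4P; split; [exact: twin_class_center t|exact: twin_class_side t| |].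
  by apply/eqP/setP => x; rewrite !inE; case: (x \in A); rewrite ?andbF.
by rewrite setIC setID.
Qed.

(** Every biclique of the component is the centre of a triple or next to a
    centre; this passes on from a biclique to those it meets. *)
Lemma triple_split A B Q R : triple A B Q -> R \in component A ->
  exists X Y, link X Y /\ R = X :|: Y.
Proof.
move=> t Rc.
have : (exists B Q, triple R B Q) \/ (exists A Q, triple A R Q).
  apply: (@component_ind A (fun R => (exists B Q, triple R B Q) \/ (exists A Q, triple A R Q)))
    Rc; first by left; exists B, Q.
  move=> {}R S [[{t}B [{}Q t]]|[{t}A [{}Q t]]] mR mS /set0Pn[x /setIP[xR xS]].
    case: (triple_only t mS xS xR) => ->.
    - by left; exists B, Q.
    - by right; exists R, Q.
    - by right; exists R, B; apply: triple_sym.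
  have [[mA _ _] AR _ _] := t.
  case: (set_0Vmem (S :&: A)) => [SA|[u /setIP[uS uA]]].
    right; exists R, A; split=> //; [|by rewrite setIC|by rewrite -setIA SA setI0].
    by apply/set0Pn; exists x; rewrite inE xR.
  case: (triple_only t mS uS uA) => ->.
  - by left; exists R, Q.
  - by right; exists A, Q.
  - by right; exists A, R; apply: triple_sym.
case=> [[B1 [Q1 {}t]]|[A1 [Q1 {}t]]]; have [_ _ eA _] := triple_card t.
  by exists (R :&: B1), (R :&: Q1); split; [exact: link_center|].
by exists (A1 :&: R), (R :\: A1); split; [exact: link_side t|rewrite setIC setID].
Qed.

Lemma link_twin_class X Y : link X Y -> twin_class X /\ twin_class Y. Proof. by case/and4P. Qed.
Lemma link_biclique X Y : link X Y -> max_biclique (X :|: Y). Proof. by case/and4P. Qed.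

(** The three classes are disjoint and have [3 * p = d] vertices together; they
    lie in both neighbourhoods of [x], which have at most [d]. *)
Lemma link_full X Y Z x : link X Y -> link X Z -> Y != Z -> x \in X ->
  out_nbhd x = X :|: Y :|: Z /\ in_nbhd x = X :|: Y :|: Z.
Proof.
move=> eXY eXZ YZ xX.
have [cX cY] := link_twin_class eXY; have [_ cZ] := link_twin_class eXZ.
have /and4P[_ _ /eqP XY mXY] := eXY; have /and4P[_ _ /eqP XZ mXZ] := eXZ.
have sub (N : {set D}) : X :|: Y \subset N -> X :|: Z \subset N -> X :|: Y :|: Z \subset N.
  by rewrite !subUset => -> /andP[].
have cU : #|X :|: Y :|: Z| = d.
  rewrite cardsU setIUl XZ (twin_class_disj cY cZ YZ) setU0 cards0 subn0.
  by rewrite cardsU XY cards0 subn0 !twin_class_card // dE; lia.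
have [xXY xXZ] : x \in X :|: Y /\ x \in X :|: Z by rewrite !inE xX.
split; apply/esym/eqP; rewrite eqEcard cU.
  by rewrite card_out_nbhd andbT; apply: sub; apply: max_biclique_sub_out.
by rewrite card_in_nbhd andbT; apply: sub; apply: max_biclique_sub_in.
Qed.

Lemma link_deg2 X Y Z W : link X Y -> link X Z -> link X W -> Y != Z -> (W == Y) || (W == Z).
Proof.
move=> eXY eXZ eXW YZ; have [cX cY] := link_twin_class eXY; have [_ cZ] := link_twin_class eXZ.
have [_ cW] := link_twin_class eXW.
have [x xX] := twin_class_witness cX.
have [w wW] := twin_class_witness cW.
have [NE _] := link_full eXY eXZ YZ xX.
have : w \in X :|: Y :|: Z.
  by rewrite -NE (subsetP (max_biclique_sub_out (link_biclique eXW) _)) // inE ?xX ?wW ?orbT.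
rewrite !inE -orbA => /or3P[wX|wY|wZ].
- by move: eXW; rewrite -(twin_class_eq cX cW wX wW) link_irr.
- by rewrite (twin_class_eq cW cY wW wY) eqxx.
- by rewrite (twin_class_eq cW cZ wW wZ) eqxx orbT.
Qed.

(** A component [C] given by its sequence [X 0, ..., X m.-1] of classes. *)
Section ClassPath.
Variables (C : {set {set D}}) (X : nat -> {set D}) (m : nat).
Hypothesis m_gt1 : 1 < m.
Hypothesis X_inj : forall i j, i < m -> j < m -> X i = X j -> i = j.
Hypothesis X_step : forall i, i.+1 < m -> link (X i) (X i.+1).
Hypothesis X_adj : forall i j, i < m -> j < m -> link (X i) (X j) ->
  [\/ j = i.+1, i = j.+1, i = 0 /\ j = m.-1 | j = 0 /\ i = m.-1].
Hypothesis X_closed : forall i Y, i < m -> link (X i) Y ->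
  (exists2 j, j < m & Y = X j) /\ X i :|: Y \in C.
Hypothesis C_X : forall R, R \in C ->
  exists i j, [/\ i < m, j < m, link (X i) (X j) & R = X i :|: X j].

Lemma X_nbr i : i < m -> exists2 j, j < m & link (X i) (X j).
Proof.
move=> im; case: (ltnP i.+1 m) => il; first by exists i.+1 => //; apply: X_step.
by exists i.-1; [lia|rewrite link_sym -{2}(@prednK i) ?X_step; lia].
Qed.

Lemma X_class i : i < m -> twin_class (X i).
Proof. by case/X_nbr => j _ /link_twin_class[]. Qed.

Lemma X_disj i j x : i < m -> j < m -> x \in X i -> x \in X j -> i = j.
Proof.
by move=> im jm xi xj; apply: X_inj => //; apply: twin_class_eq xi xj; apply: X_class.
Qed.

Lemma X_cover i x : i < m -> x \in X i -> x \in cover C.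
Proof.
move=> im xi; have [j jm eij] := X_nbr im; have [_ XC] := X_closed im eij.
by apply/bigcupP; exists (X i :|: X j); rewrite // inE xi.
Qed.

(** For [m = 2] the ends of the path are consecutive, and do not close it. *)
Definition closed_path := (2 < m) && link (X 0) (X m.-1).
(** These classes are linked to two others, and hence have no neighbours in [D]
    outside of them. *)
Definition saturated i := (0 < i) && (i.+1 < m) || closed_path.

Lemma saturated_two i : i < m -> saturated i ->
  exists j k, [/\ j < m, k < m, j != k, link (X i) (X j) & link (X i) (X k)].
Proof.
have down j : 0 < j -> j < m -> link (X j) (X j.-1).
  by move=> j0 jm; rewrite link_sym -{2}(@prednK j) ?X_step; lia.
move=> im; case: (posnP i) => [-> |i0] /=.
  rewrite /saturated /= => /andP[m2 e]; exists 1, m.-1.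
  by split; [exact: m_gt1|lia|lia|apply: X_step|].
case: (ltnP i.+1 m) => il.
  by exists i.-1, i.+1; split; [lia|lia|lia|exact: down|exact: X_step].
rewrite /saturated (ltnNge i.+1) il andbF /= => /andP[m2 e].
have im1 : i = m.-1 by lia.
by exists i.-1, 0; split; [lia|lia|lia|exact: down|rewrite im1 link_sym].
Qed.

Lemma saturated_nbrs i x w : i < m -> saturated i -> x \in X i -> arc x w || arc w x ->
  exists2 j, j < m /\ w \in X j & j = i \/ link (X i) (X j).
Proof.
move=> im fi xi axw; have [j [k [jm km jk eij eik]]] := saturated_two im fi.
have nX : X j != X k by apply: contraNneq jk => /X_inj ->.
have [Np_x Nm_x] := link_full eij eik nX xi.
have : w \in X i :|: X j :|: X k.
  by case/orP: axw => a; [rewrite -Np_x|rewrite -Nm_x]; rewrite inE a orbT.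
rewrite !inE -orbA => /or3P[wi|wj|wk].
- by exists i; [|left].
- by exists j; [|right].
- by exists k; [|right].
Qed.

(** Three pairwise linked classes would form a biclique of [3 * p] vertices. *)
Lemma closed_path_neq3 : closed_path -> m != 3.
Proof.
case/andP => _ e02; apply/eqP => m3; rewrite m3 /= in e02.
have e01 : link (X 0) (X 1) by apply: X_step; rewrite m3.
have e12 : link (X 1) (X 2) by apply: X_step; rewrite m3.
have [m01 m12 m02] := And3 (link_biclique e01) (link_biclique e12) (link_biclique e02).
have [c0 c1] := link_twin_class e01; have [_ c2] := link_twin_class e02.
have bU : biclique (X 0 :|: X 1 :|: X 2).
  apply/bicliqueP => u v; rewrite !inE -!orbA => /or3P[] uX /or3P[] vX;
    first [apply: (max_biclique_arc m01); rewrite inE ?uX ?vX ?orbT //; fail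
          |apply: (max_biclique_arc m12); rewrite inE ?uX ?vX ?orbT //; fail
          |apply: (max_biclique_arc m02); rewrite inE ?uX ?vX ?orbT //; fail].
have := card_biclique_le bU; rewrite leqNgt -(max_biclique_card m01) => /negP; apply.
apply: proper_card; rewrite properUl //; apply/subsetPn.
have [x x2] := twin_class_witness c2.
exists x => //; rewrite inE negb_or; apply/andP; split; apply/negP => xX.
  by move: e02; rewrite (twin_class_eq c0 c2 xX x2) link_irr.
by move: e12; rewrite (twin_class_eq c1 c2 xX x2) link_irr.
Qed.

(** On a closed path all classes are saturated, so the union of the classes is
    closed under taking neighbours. *)
Lemma cycle_all w : connected_digraph D -> closed_path -> exists2 i, i < m & w \in X i.
Proof.
move=> hconn hc.
have [x0 x0X] := twin_class_witness (X_class (ltnW m_gt1)).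
have Px0 : exists2 i, i < m & x0 \in X i by exists 0 => //; lia.
have /connectP[q] := hconn x0 w.
elim: q x0 Px0 {x0X} => [|y q IH] x Px /=; first by move=> _ ->.
case/andP => axy; apply: IH; case: Px => i im xi.
by have [|j [jm yj] _] := saturated_nbrs im _ xi axy; [rewrite /saturated hc orbT|exists j].
Qed.

Lemma link_cycle (i j : 'I_m) : closed_path -> link (X i) (X j) = edge (u := cycle_graph m) i j.
Proof.
move=> hc; have /andP[m2 eend] := hc; rewrite /= /cycle_edge.
have oS (k l : 'I_m) :
    (l == ordS k) = (l == k.+1 :> nat) || ((k == m.-1 :> nat) && (l == 0 :> nat)).
  rewrite -val_eqE /=; have := ltn_ord k; have := ltn_ord l => lm km.
  case: (ltnP k.+1 m) => kl; first by rewrite modn_small //; lia.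
  by have -> : k.+1 = m by [lia]; rewrite modnn; lia.
rewrite !oS; apply/idP/idP => [e|].
  rewrite -val_eqE /=.
  have ij : (i != j :> nat) by apply: contraTneq e => ->; rewrite link_irr.
  by rewrite ij; case: (X_adj (ltn_ord i) (ltn_ord j) e) => [->|->|[-> ->]|[-> ->]];
    rewrite !eqxx ?orbT.
case/andP=> _ /orP[/orP[/eqP h|/andP[/eqP h1 /eqP h2]]|/orP[/eqP h|/andP[/eqP h1 /eqP h2]]].
- by rewrite h X_step // -h ltn_ord.
- by rewrite h1 h2 link_sym.
- by rewrite h link_sym X_step // -h ltn_ord.
- by rewrite h1 h2.
Qed.

(** Vertices of the same or of linked classes are joined in both directions, and
    no others are joined at all. The isomorphism numbers each class by its
    enumeration. *)
Lemma cycle_iso : connected_digraph D -> closed_path ->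
  digraph_iso D (bidirected (lex_product (cycle_graph m) (complete_graph p))).
Proof.
move=> hconn hc.
have [x0 _] := twin_class_witness (X_class (ltnW m_gt1)).
pose g (a : 'I_m * 'I_p) := nth x0 (enum (X a.1)) a.2.
have szX (i : 'I_m) : size (enum (X i)) = p by rewrite -cardE (twin_class_card (X_class _)).
have gX a : g a \in X a.1 by rewrite -mem_enum mem_nth // szX.
have ginj : injective g.
  move=> [i k] [j l] eg; have := gX (i, k); rewrite eg => gi.
  have ij : i = j by apply/val_inj/(X_disj _ _ gi (gX (j, l))).
  move: eg; rewrite /g -ij /= => /eqP; rewrite nth_uniq ?szX ?enum_uniq // => /eqP kl.
  by congr (_, _); apply: val_inj.
have gsurj w : exists a, w = g a.
  have [i im wi] := cycle_all w hconn hc.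
  have lt : index w (enum (X i)) < p.
    by rewrite -(szX (Ordinal im)) index_mem mem_enum.
  by exists (Ordinal im, Ordinal lt); rewrite /g /= nth_index // mem_enum.
have [h gh hg] : bijective g.
  apply: inj_card_bij => //.
  apply: leq_trans (leq_image_card g predT); apply: subset_leq_card; apply/subsetP => w _.
  by have [a ->] := gsurj w; apply: image_f.
exists h; first by exists g.
suff arcg a b : arc (g a) (g b) =
    arc (d := bidirected (lex_product (cycle_graph m) (complete_graph p))) a b.
  by move=> u v; rewrite -arcg !hg.
have -> : arc (d := bidirected (lex_product (cycle_graph m) (complete_graph p))) a b =
   edge (u := cycle_graph m) a.1 b.1 || (a.1 == b.1) && (a.2 != b.2) by [].
rewrite -link_cycle //; apply/idP/idP => [ag|].
  have ag' : arc (g a) (g b) || arc (g b) (g a) by rewrite ag.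
  have fa : saturated a.1 by rewrite /saturated hc orbT.
  have [j [jm gj] [ja|ja]] := saturated_nbrs (ltn_ord a.1) fa (gX a) ag'.
    have ab : a.1 = b.1 by apply: val_inj; rewrite /= -ja; apply: X_disj gj (gX b).
    rewrite ab eqxx /=; apply/orP; right; apply: contraTneq ag => a2b2.
    have -> : a = b by case: a b ab a2b2 {fa gj ag' ja} => [? ?] [? ?] /= -> ->.
    by rewrite arc_irr.
  by rewrite -(X_disj jm (ltn_ord b.1) gj (gX b)) ja.
case/orP => [e|/andP[/eqP ab nab]].
  apply: (proj1 (max_biclique_arc (link_biclique e) _ _ _)); first by rewrite inE gX.
    by rewrite inE gX orbT.
  apply: contraTneq e => gab; have := gX a; rewrite gab => h1.
  by rewrite (X_disj (ltn_ord _) (ltn_ord _) h1 (gX b)) link_irr.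
have [j jm e] := X_nbr (ltn_ord a.1).
apply: (proj1 (max_biclique_arc (link_biclique e) _ _ _)); first by rewrite inE gX.
  by rewrite inE ab gX.
by apply: contra nab => /eqP/ginj ->.
Qed.

Hypothesis even_cyc : closed_path -> ~~ odd m.

(** Consecutive indices have different parity, and so do the ends [0] and
    [m.-1] of a closed path when its length [m] is even. *)
Lemma X_parity i j : i < m -> j < m -> link (X i) (X j) -> odd i != odd j.
Proof.
have ends : link (X 0) (X m.-1) -> odd m.-1.
  move=> e; case: (ltnP 2 m) => m2; last by have -> : m = 2 by lia.
  by have := even_cyc; rewrite /closed_path m2 e => /(_ isT); lia.
move=> im jm eij; case: (X_adj im jm eij) => [->|->|[i0 j1]|[j0 i1]].
- by rewrite /=; case: (odd i).
- by rewrite /=; case: (odd j).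
- by move: eij; rewrite i0 j1 => /ends ->.
- by move: eij; rewrite j0 i1 link_sym => /ends ->.
Qed.

(** Representatives of one side of the bipartition of the path or cycle. *)
Definition side (b : bool) (t : nat -> D) :=
  [set x | [exists i : 'I_m, (odd i == b) && (x == t i)]].

Lemma sideP b t x : reflect (exists2 i, i < m /\ odd i = b & x = t i) (x \in side b t).
Proof.
rewrite inE; apply: (iffP existsP) => [[i /andP[/eqP ob /eqP xt]]|[i [im ob] xt]].
  by exists i.
by exists (Ordinal im); rewrite /= ob xt !eqxx.
Qed.

(** Each biclique consists of two linked classes, one of which has the parity
    [b]. Two distinct vertices of [side b t] are not joined, because one of them is not
    [v] and lies in a saturated class, to which the class of the other is not
    linked. *)
Lemma side_picks b t v : (forall i, i < m -> t i \in X i) ->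
  (forall i, i < m -> odd i = b -> saturated i \/ t i = v) -> picks C v (side b t).
Proof.
move=> tX tfull; split.
- by apply/subsetP => x /sideP[i [im _] ->]; apply: X_cover im (tX _ im).
- move=> R /C_X[i [j [im jm eij ->]]]; have par := X_parity im jm eij.
  apply/set0Pn; have [ib|ib] := eqVneq (odd i) b.
    exists (t i); rewrite !inE tX //= andbT; apply/existsP.
    by exists (Ordinal im); rewrite /= ib !eqxx.
  have jb : odd j == b by move: par ib; case: (odd i) (odd j) (b) => [] [] [].
  exists (t j); rewrite !inE tX //= orbT andbT; apply/existsP.
  by exists (Ordinal jm); rewrite /= jb !eqxx.
- have aux i j : i < m -> j < m -> odd i = b -> odd j = b -> saturated i ->
      arc (t i) (t j) || arc (t j) (t i) -> i = j.
    move=> im jm ib jb fi a.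
    have [k [km tk] ki] := saturated_nbrs im fi (tX _ im) a.
    have jk := X_disj jm km (tX _ jm) tk; rewrite -jk in ki.
    by case: ki => // /(X_parity im jm); rewrite ib jb eqxx.
  move=> u w /sideP[i [im ib] ->] /sideP[j [jm jb] ->]; apply/negP => a.
  have aij : arc (t i) (t j) || arc (t j) (t i) by rewrite a.
  case: (tfull i im ib) => [fi|ti].
    by move: a; rewrite (aux i j) ?arc_irr.
  case: (tfull j jm jb) => [fj|tj]; last by move: a; rewrite ti tj arc_irr.
  by move: a; rewrite (aux j i) ?arc_irr // orbC.
- move=> u w /sideP[i [im ib] ->] tv a; case: (tfull i im ib) => [fi|ti]; last first.
    by rewrite ti eqxx in tv.
  have a' : arc (t i) w || arc w (t i) by rewrite a orbT.
  have [j [jm wj] _] := saturated_nbrs im fi (tX _ im) a'.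
  exact: X_cover jm wj.
Qed.

(** On a path with an even number of classes the two ends have different parity.
    The choice of [v] in one of the end classes decides which side is taken, and
    [v] is then the representative of its class. In all other cases the odd classes
    are saturated, so a fixed choice in them serves, and [V] can be any saturated
    class: none of its vertices has a neighbour outside the component. *)
Lemma path_gadget : exists V g, gadget C V g.
Proof.
have [x0 _] := twin_class_witness (X_class (ltnW m_gt1)).
pose t i := odflt x0 [pick x in X i].
have tX i : i < m -> t i \in X i.
  move=> im; rewrite /t; case: pickP => //= e0.
  by have := twin_class_card (X_class im); rewrite (eq_card0 e0) => p0; move: p_gt0; rewrite -p0.
have inC v i : i < m -> v \in X i -> #|[set w | arc v w] :\: cover C| <= p.
  move=> im vi; have [j jm eij] := X_nbr im; have [_ XC] := X_closed im eij.
  apply: out_cover (link_biclique eij) _; first by rewrite inE vi.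
  by apply: (bigcup_max (X i :|: X j)).
case: (boolP ((~~ closed_path) && ~~ odd m)) => [/andP[ncyc em]|fullodd].
- have m1 : m.-1 < m by lia.
  exists (X 0 :|: X m.-1).
  exists (fun v => side (v \notin X 0) (fun i => if v \in X i then v else t i)).
  have V1 v : v \in X 0 :|: X m.-1 -> exists2 i, i < m & v \in X i.
    by case/setUP => vX; [exists 0; [lia|]|exists m.-1].
  split.
  + by apply/set0Pn; exists (t 0); rewrite inE tX //; lia.
  + by apply/subsetP => v /V1[i im vi]; apply: X_cover im vi.
  + move=> v /V1[i im vi] /=; have := inC v i im vi; split=> //.
    have nX : X 0 != X m.-1 by apply/eqP => /X_inj; lia.
    rewrite cardsU (twin_class_disj _ _ nX) ?X_class //; last by lia.
    by rewrite cards0 subn0 !(twin_class_card (X_class _)) //; lia.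
  + move=> v vV; apply: side_picks => [i im|i im ib].
      by case: ifP => // _; apply: tX.
    have [fi|nfi] := boolP (saturated i); [by left|right]; rewrite ifT //.
    have i01 : i = 0 \/ i = m.-1.
      by move: nfi; rewrite /saturated negb_or negb_and => /andP[/orP[]]; lia.
    case: i01 => iE; move: ib; rewrite iE.
      by move=> /esym/negbFE.
    have -> : odd m.-1 by lia.
    by move=> /esym vX0; case/setUP: vV => //; rewrite (negbTE vX0).
have odd_full i : i < m -> odd i -> saturated i.
  move=> im oi; rewrite /saturated; case: (boolP closed_path) fullodd => [_|_ /= ].
    by rewrite orbT.
  by rewrite negbK orbF; lia.
exists (X 1), (fun=> side true t); split.
- by apply/set0Pn; exists (t 1); apply: tX.
- by apply/subsetP => v; apply: X_cover.
- move=> v vX; have -> : [set w | arc v w] :\: cover C = set0.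
    apply/setP => w; rewrite !inE; apply/negP => /andP[/negP wC a]; apply: wC.
    have a' : arc v w || arc w v by rewrite a.
    have [j [jm wj] _] := saturated_nbrs m_gt1 (odd_full 1 m_gt1 isT) vX a'.
    exact: X_cover jm wj.
  by rewrite cards0 (twin_class_card (X_class _)).
- by move=> v _; apply: side_picks => // i im oi; left; apply: odd_full.
Qed.

End ClassPath.
(** The classes of the component of [A] are the [link]-component of [A :&: B]. A
    biclique that meets the union of two of these classes shares a vertex with one
    of them, and is itself split into two classes by [triple_split]; since classes
    are disjoint or equal, one of these two is already on the path. *)
Lemma path_struct A B Q : triple A B Q -> exists (X : nat -> {set D}) (m : nat),
  [/\ 1 < m, forall i j, i < m -> j < m -> X i = X j -> i = j,
      forall i, i.+1 < m -> link (X i) (X i.+1),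
      forall i j, i < m -> j < m -> link (X i) (X j) ->
        [\/ j = i.+1, i = j.+1, i = 0 /\ j = m.-1 | j = 0 /\ i = m.-1]
    & (forall i Y, i < m -> link (X i) Y ->
         (exists2 j, j < m & Y = X j) /\ X i :|: Y \in component A) /\
      (forall R, R \in component A ->
         exists i j, [/\ i < m, j < m, link (X i) (X j) & R = X i :|: X j])].
Proof.
move=> t; have [_ _ eA _] := triple_card t; have [[mA mB mQ] AB _ _] := t.
have e0 := link_center t; set X0 := A :&: B in e0 eA AB *.
have X0A : X0 \subset A := subsetIl _ _.
have [s [us X0s ss scl sadj]] := deg2_component X0 link_sym link_irr link_deg2.
have sC Y : Y \in s -> forall Z, link Y Z -> Y :|: Z \in component A.
  move=> Ys; have : connect link X0 Y.
    case: s ss X0s Ys {us scl sadj} => // y0 q pq X0s Ys.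
    have c := path_connect pq; apply: (connect_trans _ (c Y Ys)).
    by rewrite (sym_connect_sym link_sym) c.
  case/connectP => q; elim/last_ind: q Y {Ys} => [|q W IH] Y /=.
    move=> _ -> Z eZ; apply: component_meets (component_refl _) mA (link_biclique eZ) _.
    case/set0Pn: AB => x xX; apply/set0Pn; exists x.
    by rewrite in_setI in_setU xX (subsetP X0A).
  rewrite rcons_path last_rcons => /andP[pq eW] -> Z eZ.
  have := IH _ pq erefl _ eW => cW.
  apply: component_meets cW (link_biclique eW) (link_biclique eZ) _.
  have [x xW] := twin_class_witness (proj1 (link_twin_class eZ)).
  by apply/set0Pn; exists x; rewrite !inE xW orbT.
have sR R : R \in component A -> exists Y Z, [/\ Y \in s, Z \in s, link Y Z & R = Y :|: Z].
  move=> Rc; suff [] : R \in component A /\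
      exists Y Z, [/\ Y \in s, Z \in s, link Y Z & R = Y :|: Z] by [].
  apply: (@component_ind A (fun R => R \in component A /\
      exists Y Z, [/\ Y \in s, Z \in s, link Y Z & R = Y :|: Z])) Rc.
    split; first exact: component_refl.
    by exists X0, (A :&: Q); split=> //; apply: scl e0.
  move=> {}R S [Rc [Y [Z [Ys Zs eYZ RE]]]] mR mS RS.
  have Sc := component_meets Rc mR mS RS; split=> //.
  have [Y' [Z' [eYZ' SE]]] := triple_split t Sc.
  have [cY cZ] := link_twin_class eYZ.
  have [W [Ws cW] [x xW xS]] : exists2 W, W \in s /\ twin_class W & exists2 x, x \in W & x \in S.
    case/set0Pn: RS => x; rewrite {1}RE inE => /andP[/setUP[xY|xZ] xS].
      by exists Y => //; exists x.
    by exists Z => //; exists x.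
  have [cY' cZ'] := link_twin_class eYZ'.
  move: xS; rewrite SE => /setUP[xY'|xZ'].
    have Y's : Y' \in s by rewrite -(twin_class_eq cW cY' xW xY').
    by exists Y', Z'; split=> //; apply: scl eYZ'.
  have Z's : Z' \in s by rewrite -(twin_class_eq cW cZ' xW xZ').
  by exists Y', Z'; split=> //; apply: scl (Z's) _; rewrite link_sym.
exists (nth X0 s), (size s).
have nthm Y : Y \in s -> exists2 j, j < size s & Y = nth X0 s j.
  by move=> Ys; exists (index Y s); rewrite ?index_mem ?nth_index.
split=> //.
- have [i im iE] := nthm _ X0s; have [j jm jE] := nthm _ (scl _ _ X0s e0).
  have ij : i != j.
    by apply: contraTneq e0 => ij; rewrite jE -ij -iE link_irr.
  by move: im jm ij; move: (size s) => k; clear; lia.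
- by move=> i j im jm /eqP; rewrite nth_uniq // => /eqP.
- by move=> i im; apply: (sortedP X0 ss).
split=> [i Y im eY|R /sR[Y [Z [/nthm[i im ->] /nthm[j jm ->] e RE]]]].
  by split; [apply: nthm; apply: scl eY; rewrite mem_nth|apply: sC eY; rewrite mem_nth].
by exists i, j.
Qed.

Lemma triple_gadget A B Q : triple A B Q -> connected_digraph D ->
  ~ (exists n q, [/\ 5 <= n, odd n, omega = 2 * q, d = 3 * q
      & digraph_iso D (bidirected (lex_product (cycle_graph n) (complete_graph q)))]) ->
  exists V g, gadget (component A) V g.
Proof.
move=> t hconn hexc; have [X [m [m1 Xinj Xstep Xadj [Xcl CX]]]] := path_struct t.
apply: (path_gadget m1 Xinj Xstep Xadj Xcl CX) => hc; apply/negP => om; apply: hexc.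
exists m, p; split=> //; [|exact: omegaE|exact: dE|exact: cycle_iso hc].
by have := closed_path_neq3 Xstep hc; have /andP[m2 _] := hc; lia.
Qed.


End Tight.

(** * Hitting all maximum bicliques *)

Hypothesis D_connected : connected_digraph D.
Hypothesis not_odd_cycle : ~ (exists n q, [/\ 5 <= n, odd n, omega = 2 * q, d = 3 * q
  & digraph_iso D (bidirected (lex_product (cycle_graph n) (complete_graph q)))]).

Lemma gadget_exists A0 : max_biclique A0 -> exists V g, gadget (component A0) V g.
Proof.
move=> mA0; case: (core_or_triple mA0) => [[v vC]|[tight [A [B [Q [Ac t]]]]]].
  exact: core_gadget vC.
by rewrite -(component_eq Ac); apply: triple_gadget tight _ _ _ t _ _.
Qed.

(** Vertices of different components are separated by [c], which maps the
    vertices of a component to the component itself. A vertex of the resulting set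
    other than the chosen vertices [M] is a source in any subset: the tail of an arc
    to it would lie in the same component, hence in the same independent set. *)
Lemma acyclic_hitting_set :
  exists I, acyclic_rel (@Defs.arc D) I /\ forall R, max_biclique R -> I :&: R != set0.
Proof.
pose isC C := exists2 A0, max_biclique A0 & C = component A0.
have [f fP] : exists f : {set {set D}} -> {set D} * (D -> {set D}),
    forall C, isC C -> gadget C (f C).1 (f C).2.
  apply: (@fin_all_exists _ _ (fun C Vg => isC C -> gadget C Vg.1 Vg.2)) => C.
  case: (pickP (fun A0 => max_biclique A0 && (C == component A0))) => [A0 /andP[mA0 /eqP ->]|none].
    by have [V [g Vg]] := gadget_exists mA0; exists (V, g).
  exists (set0, fun=> set0) => -[A0 mA0 CE].
  by have := none A0; rewrite mA0 CE eqxx.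
pose V C := (f C).1; pose g C := (f C).2.
pose c x := if [pick A | max_biclique A && (x \in A)] is Some A then component A else set0.
have cE A x : max_biclique A -> x \in A -> c x = component A.
  move=> mA xA; rewrite /c; case: pickP => [B /andP[mB xB]|/(_ A)]; last by rewrite mA xA.
  apply: component_eq; apply: component_meets (component_refl A) mA mB _.
  by apply/set0Pn; exists x; rewrite inE xA.
have cC C x : isC C -> x \in cover C -> c x = C.
  case=> A0 mA0 -> /bigcupP[B Bc xB].
  by rewrite (cE B) ?(component_eq Bc) //; apply: component_max_biclique Bc.
(* Outside all maximum bicliques, [c x] is the empty set; the first condition
   excludes these vertices. *)
pose U := [set x | (x \in cover (c x)) && (x \in V (c x))].
have isCc x : x \in cover (c x) -> isC (c x).
  rewrite /c; case: pickP => [A /andP[mA _] _|_]; first by exists A.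
  by case/bigcupP => B; rewrite inE.
have UC x : x \in U -> isC (c x) by rewrite inE => /andP[/isCc].
have UV x : x \in U -> x \in V (c x) by rewrite inE => /andP[].
have VU C x : isC C -> x \in V C -> x \in U /\ c x = C.
  move=> hC xV; have [_ /subsetP Vc _ _] := fP C hC.
  have xc : x \in cover C := Vc _ xV.
  by have e := cC C x hC xc; rewrite inE e xc.
have [|M [MU cM cMU acM]] := @acyclic_transversal D _ (@Defs.arc D) c U p.
  move=> v vU /=; have hC := UC v vU; have [_ _ Vout _] := fP _ hC.
  have [le1 le2] := Vout v (UV v vU).
  have fib : [set w in U | c w == c v] = V (c v).
    apply/setP => w; rewrite in_set; apply/andP/idP => [[wU /eqP <-]|wV]; first exact: UV.
    by have [-> ->] := VU _ _ hC wV.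
  have sub : #|[set w in U | arc v w & c v != c w]| <= #|[set w | arc v w] :\: cover (c v)|.
    apply: subset_leq_card; apply/subsetP => w; rewrite in_set => /and3P[_ a ncw].
    by rewrite in_setD in_set a andbT; apply: contra ncw => /(cC _ _ hC) ->.
  rewrite fib; split; first exact: leq_trans sub le1.
  by apply: leq_trans le2; rewrite leq_add2r.
have MP v : v \in M -> isC (c v) /\ picks (c v) v (g (c v) v).
  move=> /(subsetP MU) vU; have hC := UC v vU; split=> //.
  by have [_ _ _] := fP _ hC; apply; apply: UV.
pose I := \bigcup_(v in M) g (c v) v.
exists I; split.
  move=> B BI B0; case: (boolP (B \subset M)) => BM.
    have [b bB bsrc] := acM B BM B0; exists b => // z zB; apply/negP => azb.
    have := bsrc z zB; rewrite azb negbK => /eqP cz.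
    by move: azb; rewrite (cM z b) ?(subsetP BM) ?arc_irr.
  case/subsetPn: BM => u uB uM; exists u => // z zB; apply/negP => azu.
  have [v vM ug] := bigcupP (subsetP BI u uB).
  have [w wM zg] := bigcupP (subsetP BI z zB).
  have [hv [_ _ nov inv]] := MP v vM; have [hw [/subsetP subw _ _ _]] := MP w wM.
  have uv : u != v by apply: contraNneq uM => ->.
  have cz1 := cC _ _ hv (inv _ _ ug uv azu).
  have cz2 := cC _ _ hw (subw _ zg).
  have vw : v = w by apply: cM => //; rewrite -cz1 -cz2.
  by move: zg; rewrite -vw => zg; have := nov z u zg ug; rewrite azu.
move=> R mR; have hC : isC (component R) by exists R.
have [/set0Pn[x xV] _ _ _] := fP _ hC; have [xU cx] := VU _ _ hC xV.
have : c x \in c @: M by rewrite cMU imset_f.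
case/imsetP => v vM; rewrite cx => cv; have [_ [_ hit _ _]] := MP v vM.
have Rc : R \in c v by rewrite -cv component_refl.
have /set0Pn[y /setIP[yg yR]] := hit R Rc.
by apply/set0Pn; exists y; rewrite in_setI yR andbT; apply/bigcupP; exists v.
Qed.


End Bicliques.

Lemma acyclic_rel_set (D : digraph) (I : {set D}) : acyclic_rel (@Defs.arc D) I -> acyclic_set I.
Proof.
move=> acI c; apply/negP => /and3P[c0 _ closed_path].
have acT : acyclic_rel (@Defs.arc (induced I)) [set: _].
  move=> B _ /set0Pn[u uB].
  have [||_ /imsetP[b bB ->] src] := acI (val @: B).
  - by apply/subsetP => _ /imsetP[v _ ->]; apply: valP.
  - by apply/set0Pn; exists (val u); apply: imset_f.
  by exists b => // z zB; apply: src; apply: imset_f.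
by have /allP[] := acyclic_rel_cycle acT c0 closed_path => x; rewrite inE.
Qed.

Lemma degrees_le_maxdeg (D : digraph) (v : D) : outdeg v <= maxdeg D /\ indeg v <= maxdeg D.
Proof.
have le : maxn (outdeg v) (indeg v) <= maxdeg D by apply: (bigmax_sup v).
by split; apply: leq_trans le; rewrite ?leq_maxl ?leq_maxr.
Qed.

Import Order.TTheory GRing.Theory Num.Theory.
Local Open Scope ring_scope.

Theorem theorem5p2 (D : digraph) (Delta : int)
    (hconn : connected_digraph D)
    (hdeg : (maxdeg D)%:Z <= Delta)
    (homega : 2 / 3 * (Delta%:~R + 1) <= (biclique_number D)%:R :> rat)
    (hexc : ~ exists n p : nat,
        [/\ (5 <= n)%N,
            odd n,
            p%:R = 1 / 2 * (biclique_number D)%:R :> rat,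
            p%:R = 1 / 3 * (Delta%:~R + 1) :> rat
          & digraph_iso D
              (bidirected (lex_product (cycle_graph n) (complete_graph p)))]) :
  exists I : {set D},
    acyclic_set I /\
    (biclique_number (del_vertices I))%:Z = (biclique_number D)%:Z - 1.
Proof.
case: Delta hdeg homega hexc => [n|n] //; rewrite lez_nat -pmulrn.
move=> hdeg homega hexc; set w := biclique_number D in homega hexc *.
have out_lt (v : D) : (outdeg v < n.+1)%N.
  by rewrite ltnS; apply: leq_trans hdeg; case: (degrees_le_maxdeg v).
have in_lt (v : D) : (indeg v < n.+1)%N.
  by rewrite ltnS; apply: leq_trans hdeg; case: (degrees_le_maxdeg v).
have w_ge : (2 * n.+1 <= 3 * w)%N.
  by rewrite -(ler_nat rat) !natrM -natr1; lra.
have w_gt0 : (0 < w)%N by lia.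
have hexc' : ~ (exists m q, [/\ (5 <= m)%N, odd m, w = (2 * q)%N, n.+1 = (3 * q)%N
    & digraph_iso D (bidirected (lex_product (cycle_graph m) (complete_graph q)))]).
  case=> m [q [m5 om wq nq iso]]; apply: hexc; exists m, q; split=> //.
    by rewrite wq natrM; lra.
  by rewrite natr1 nq natrM; lra.
have [I [acI hit]] := acyclic_hitting_set w_gt0 out_lt in_lt w_ge hconn hexc'.
exists I; split; first exact: acyclic_rel_set acI.
by rewrite (biclique_number_del w_gt0 acI hit) -subn1 -subzn.
Qed.
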